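(* Let $G$ be any compact, connected (Hausdorff, abelian) topological group with Haar probability measure $\mu$, and let $\mathbf{b}\in G\setminus\{\mathbf{0}\}$. Then for every $\pi\in\mathcal{M}_{\mathbf{b}}(G)$ the function $-\ln(\pi)$ is integrable (i.e. $\int_G-\ln(\pi)\,d\mu<\infty$), and $$\inf\left\{\int_G\ln(\pi)\,d\mu\;:\;\pi\in\mathcal{M}_{\mathbf{b}}(G)\right\}=-1.$$ If $G=\mathbb{T}^n=\mathbb{R}^n/\mathbb{Z}^n$, the infimum is attained by $\operatorname{GMI}^n_{\mathbf{b}_i}$ for any index $i\in\{1,\dots,n\}$ such that $\mathbf{b}_i\neq 0$.
   Context: For an abelian group $G$ and $\mathbf{b}\in G\setminus\{\mathbf{0}\}$, let $I_{\mathbf{b}}(G)$ be the set of finite-support functions $y:G\to\mathbb{Z}_{\ge 0}$ with $\sum_{\mathbf{x}\in G}y(\mathbf{x})\,\mathbf{x}=\mathbf{b}$. A function $\pi:G\to\mathbb{R}_+$ (nonnegative reals) is valid if $\sum_{\mathbf{x}\in G}\pi(\mathbf{x})y(\mathbf{x})\ge 1$ for every $y\in I_{\mathbf{b}}(G)$, and a valid $\pi:G\to\mathbb{R}_+$ is minimal if every valid $\tilde\pi:G\to\mathbb{R}_+$ with $\tilde\pi\le\pi$ pointwise satisfies $\tilde\pi=\pi$. By a known theorem of Gomory and Johnson, $\pi:G\to\mathbb{R}_+$ is minimal if and only if $\pi(\mathbf{0})=0$, $\pi(\mathbf{x})+\pi(\mathbf{y})\ge\pi(\mathbf{x}+\mathbf{y})$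 for all $\mathbf{x},\mathbf{y}\in G$, and $\pi(\mathbf{x})+\pi(\mathbf{b}-\mathbf{x})=1$ for all $\mathbf{x}\in G$. For a compact topological group $G$, $\mathcal{M}_{\mathbf{b}}(G)$ denotes the set of minimal functions that are measurable with respect to the Haar measure $\mu$ (normalized so that $\mu(G)=1$). Convention: $\ln(0)=-\infty$, so $-\ln(\pi)$ is a $[0,+\infty]$-valued function (minimal functions take values in $[0,1]$) and its integral is always defined in $[0,+\infty]$. For $G=\mathbb{T}^n$ and an index $i$ with $\mathbf{b}_i\ne 0$, $\operatorname{GMI}^n_{\mathbf{b}_i}:\mathbb{T}^n\to\mathbb{R}_+$ is defined by $\operatorname{GMI}^n_{\mathbf{b}_i}(\mathbf{x})=\frac{\mathbf{x}_i}{\mathbf{b}_i}$ if $\mathbf{x}_i\le\mathbf{b}_i$ and $\operatorname{GMI}^n_{\mathbf{b}_i}(\mathbf{x})=\frac{1-\mathbf{x}_i}{1-\mathbf{b}_i}$ otherwise, where the coordinates $\mathbf{x}_i,\mathbf{b}_i$ are interpreted as real numbers in $[0,1)$. *)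

(* Defs.v *)
From HB Require Import structures.
From mathcomp Require Import all_boot all_order all_algebra.
From mathcomp Require Import all_classical all_reals all_analysis.

Set Implicit Arguments.
Unset Strict Implicit.
Unset Printing Implicit Defensive.

Import Order.TTheory GRing.Theory Num.Theory.
Import numFieldNormedType.Exports.

Local Open Scope classical_set_scope.
Local Open Scope ring_scope.

(* The library points every zmodType at 0, but does not extend this to
   topologicalZmodType; the carrier of a measurable type has to be pointed. *)
HB.instance Definition _ (G : topologicalZmodType) := isPointed.Build G 0.

Definition borel (G : topologicalZmodType) := g_sigma_algebraType (@open G).

HB.instance Definition _ (G : topologicalZmodType) := Measurable.on (borel G).

Section haar.
Variables (R : realType) (G : topologicalZmodType).
Variable mu : probability (borel G) R.

(* Only meant for compact Hausdorff G, where compact sets are Borel. *)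
Record is_haar : Prop := IsHaar {
  haar_translation : forall (x : G) (A : set G),
    measurable (A : set (borel G)) -> mu [set x + a | a in A] = mu A ;
  haar_outer_regular : forall A : set G, measurable (A : set (borel G)) ->
    mu A = ereal_inf [set mu U | U in [set U : set G | open U /\ A `<=` U]] ;
  haar_inner_regular : forall U : set G, open U ->
    mu U = ereal_sup [set mu K | K in [set K : set G | compact K /\ K `<=` U]]
}.

(* The completion of mu, a measure on the sigma-algebra of mu-measurable sets
   (a priori larger than the Borel one). *)
Definition haar_completion : {measure set (caratheodory_type (mu^*)%mu) -> \bar R} :=
  @completed_measure_extension _ _ _ mu.

End haar.

Section minimal_functions.
Variables (R : realType) (G : zmodType) (b : G).

Definition infinite_relaxation : set (G -> nat) :=
  [set y | finite_set [set x | y x != 0%N] /\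
           \sum_(x \in [set: G]) x *+ y x = b].

Definition valid (pi : G -> R) : Prop :=
  (forall x, 0 <= pi x) /\
  (forall y, infinite_relaxation y ->
     1 <= \sum_(x \in [set: G]) pi x * (y x)%:R).

Definition minimal (pi : G -> R) : Prop :=
  valid pi /\
  (forall pi', valid pi' -> (forall x, pi' x <= pi x) -> pi' = pi).

End minimal_functions.

Section measurable_minimal_functions.
Variables (R : realType) (G : topologicalZmodType).
Variable mu : probability (borel G) R.

Definition minimal_measurable (b : G) : set (G -> R) :=
  [set pi | minimal b pi /\
    measurable_fun [set: caratheodory_type (mu^*)%mu] pi].

Definition log_integral (pi : G -> R) : \bar R :=
  (\int[haar_completion mu]_x lne (pi x)%:E)%E.

End measurable_minimal_functions.

Section torus.
Variables (R : realType) (n : nat).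

Definition int_rV : {pred 'rV[R]_n} := fun v => v \is a mxOver Num.int.

Fact int_rV_zmod_closed : zmod_closed int_rV.
Proof.
split=> [|u v /mxOverP uZ /mxOverP vZ]; apply/mxOverP => i j; rewrite !mxE.
  exact: rpred0.
by apply: rpredB; [exact: uZ|exact: vZ].
Qed.

HB.instance Definition _ :=
  GRing.isZmodClosed.Build 'rV[R]_n int_rV int_rV_zmod_closed.

Definition torus : Type := quotient_topology (Quotient.quot int_rV).

HB.instance Definition _ := Topological.on torus.
HB.instance Definition _ := Quotient.on torus.
(* Not a copy of the instance of the library: the choice structures that the
   topological and the algebraic quotients come with differ. *)
HB.instance Definition _ := GRing.isZmodule.Build torus
  (@Quotient.addqA _ int_rV) (@Quotient.addqC _ int_rV)
  (@Quotient.add0q _ int_rV) (@Quotient.addNq _ int_rV).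

Definition torus_pi : 'rV[R]_n -> torus := \pi_torus%qT.

Lemma torus_piB : {morph torus_pi : u v / u - v}.
Proof. exact: (raddfB (\pi_(Quotient.quot int_rV)%qT)). Qed.

Lemma torus_pi_eq u v : (torus_pi u = torus_pi v) <-> (u - v \in int_rV).
Proof.
rewrite (Quotient.idealrBE int_rV).
by split=> [uv|/eqP//]; apply/eqP.
Qed.

Lemma torus_piK (x : torus) : torus_pi (repr x) = x.
Proof. exact: reprK. Qed.

Lemma torus_pi_open (A : set 'rV[R]_n) : open A -> open (torus_pi @` A).
Proof.
move=> oA; rewrite /open /= /quotient_open.
rewrite (_ : _ @^-1` _ = \bigcup_(z in [set z | z \in int_rV])
    ((fun v => v - z) @^-1` A)); last first.
  apply/seteqP; split=> [v [u Au uv]|v [z /= zZ Avz]].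
    exists (v - u); last by rewrite /= opprB addrC subrK.
    by apply/torus_pi_eq; exact/esym.
  exists (v - z) => //; apply/torus_pi_eq.
  by rewrite addrAC subrr sub0r rpredN.
apply: bigcup_open => z _; apply: open_comp oA => v _ /=.
exact: (cvgB (@cvg_id _ (nbhs v)) (cvg_cst z)).
Qed.

Lemma torus_sub_continuous :
  continuous (fun x : torus * torus => x.1 - x.2).
Proof.
move=> [x y] W /=.
rewrite -{1}(torus_piK x) -{1}(torus_piK y) -torus_piB.
set u := repr x; set v := repr y => nW.
have /(@sub_continuous _ (u, v))[[A B] /= [nA nB] ABW] :
    nbhs (u - v) (torus_pi @^-1` W) by exact: (@pi_continuous _ _ (u - v)).
exists (torus_pi @` A°, torus_pi @` B°) => /=; first split.
- rewrite -(torus_piK x); apply: open_nbhs_nbhs; split.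
    by apply: torus_pi_open; exact: open_interior.
  by exists u.
- rewrite -(torus_piK y); apply: open_nbhs_nbhs; split.
    by apply: torus_pi_open; exact: open_interior.
  by exists v.
move=> [_ _] /= [[a Aa <-] [c Bc <-]]; rewrite -torus_piB.
by apply: (ABW (a, c)); split; exact: interior_subset.
Qed.

HB.instance Definition _ :=
  PreTopologicalNmodule_isTopologicalZmodule.Build torus torus_sub_continuous.

(* The coordinate of x read in [0, 1[: the fractional part of any lift. *)
Definition torus_coord (x : torus) (i : 'I_n) : R :=
  repr x ord0 i - (Num.floor (repr x ord0 i))%:~R.

Lemma torus_coord_pi (v : 'rV[R]_n) (i : 'I_n) :
  torus_coord (torus_pi v) i = v ord0 i - (Num.floor (v ord0 i))%:~R.
Proof.
have /torus_pi_eq/mxOverP/(_ ord0 i)/intrP[m] := torus_piK (torus_pi v).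
rewrite !mxE /torus_coord => /eqP; rewrite subr_eq => /eqP ->.
by rewrite floorDzr ?intr_int// intrKfloor intrD opprD addrACA subrr add0r.
Qed.

Lemma torus_coord_ge0_lt1 (x : torus) (i : 'I_n) : 0 <= torus_coord x i < 1.
Proof.
rewrite /torus_coord subr_ge0 ltrBlDl.
by rewrite floor_le -(intrD _ _ 1) floorD1_gt.
Qed.

Definition GMI (b : torus) (i : 'I_n) (x : torus) : R :=
  if torus_coord x i <= torus_coord b i then torus_coord x i / torus_coord b i
  else (1 - torus_coord x i) / (1 - torus_coord b i).

End torus.

(* Main.v *)
Require Import Defs.
From HB Require Import structures.
From mathcomp Require Import all_boot all_order all_algebra.
From mathcomp Require Import all_classical all_reals all_analysis.
From mathcomp Require Import finmap measurable_realfun ring lra.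

Set Implicit Arguments.
Unset Strict Implicit.
Unset Printing Implicit Defensive.

Import Order.TTheory GRing.Theory Num.Theory.
Import numFieldNormedType.Exports.

Local Open Scope classical_set_scope.
Local Open Scope ring_scope.

(** Let pi be minimal and F(t) = mu {pi <= t}, so that the integral of -ln pi
is the integral over [0, 1] of F(t)/t. Since pi is subadditive,
{pi <= s} + {pi <= t} is contained in {pi <= s + t}, and Kneser's inequality
mu(A + B) >= min(1, mu A + mu B) for connected compact groups, together with
pi(b) = 1, gives F(s) + F(t) <= F(s + t) whenever s + t < 1. Averaging this over
s + t = u shows that Phi(t)/t^2 is nondecreasing for Phi(t) the integral of F
over [0, t], and that Phi(1) <= 1/2; an integration by parts then bounds the
integral of F(t)/t by 1.

Conversely, if th is a homomorphism from G onto R/Z with th(b) <> 0, then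
GMI o th is minimal and F(t) = t, so the bound is attained. On the torus th is a
coordinate. On a general G a continuous solution c of d'Alembert's equation
c(x + y) + c(x - y) = 2 c(x) c(y) with c(b) <> 1 is the cosine of such a th. It is
found by maximizing a quadratic energy over the normalized positive-definite
functions f * f~: near-maximizers are near-eigenfunctions of all the operators
u |-> (u(. + a) + u(. - a))/2, and a limit along an ultrafilter, which is uniform
by equicontinuity, is a common eigenfunction, with eigenvalue c(a). *)

(** * Topological groups *)

(** A sum of two measurable sets can fail to be measurable, and [pi] is measurable only for the
    completed measure; Kneser's inequality is therefore proved for compact sets, which exhaust the
    sublevel sets from inside. Without connectedness an open proper subgroup [H], with [H + H = H],
    would defeat the inequality; in the proof connectedness acts only through intermediate values of
    continuous functions. The integrals against [F] are carried out as sums over a grid [j / N],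
    with [ln ((j + 1) / j)] in place of [dt / t].

    d'Alembert's equation keeps the search for a character real-valued: the cosine appears as an
    eigenvalue, and the sine is recovered from it. That [c(b) <> 1] is built into the energy: its
    kernel has the form [q - mean b q], so that the functions it produces are orthogonal to those
    fixed by [mean b]. The group need not be metrizable and the eigenvalues are indexed by all of
    it, hence an ultrafilter rather than a subsequence. *)

Section topological_group.
Context {G : topologicalZmodType}.
Implicit Types (x y : G) (A B : set G).

Lemma translation_continuous a : continuous (fun x : G => x + a).
Proof.
move=> x; apply: (@continuous_comp _ _ _ (fun x => (x, a)) (fun z => z.1 + z.2)).
  by apply: cvg_pair; [exact: cvg_id|exact: cvg_cst].
exact: add_continuous.
Qed.

Lemma reflection_continuous a : continuous (fun x : G => a - x).
Proof.
move=> x; apply: (@continuous_comp _ _ _ (fun x => (a, x)) (fun z => z.1 - z.2)).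
  by apply: cvg_pair; [exact: cvg_cst|exact: cvg_id].
exact: sub_continuous.
Qed.

Lemma continuous_translate {T : topologicalType} (f : G -> T) a :
  continuous f -> continuous (fun x => f (x + a)).
Proof.
by move=> cf x; apply: continuous_comp; [exact: translation_continuous|exact: cf].
Qed.

Lemma compact_translate A a : compact A -> compact [set x + a | x in A].
Proof.
apply: continuous_compact; apply: continuous_subspaceT => x.
exact: translation_continuous.
Qed.

Lemma compact_reflect A a : compact A -> compact [set a - x | x in A].
Proof.
apply: continuous_compact; apply: continuous_subspaceT => x.
exact: reflection_continuous.
Qed.

Definition sumset A B : set G := [set x + y | x in A & y in B].

Lemma compact_sumset A B : compact A -> compact B -> compact (sumset A B).
Proof.
move=> cA cB; rewrite (_ : sumset A B = (fun z => z.1 + z.2) @` (A `*` B)).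
  2: by apply/seteqP; split=> [_ [x Ax [y By <-]]|_ [[x y] [/= Ax By] <-]];
    [exists (x, y)|exists x => //; exists y].
apply: (@continuous_compact _ _ (fun z : G * G => z.1 + z.2)); last first.
  exact: compact_setX.
by apply: continuous_subspaceT => z; exact: add_continuous.
Qed.

(** The tube lemma for addition: compactness of [A] merges the neighbourhoods of 0 found at each
    point into one. *)
Lemma near_translate_sub A (U : set G) : compact A -> open U -> A `<=` U ->
  \forall v \near (0 : G), forall x, A x -> U (x + v).
Proof.
move=> /compact_near_coveringP cA oU AU.
have := cA G (nbhs (0 : G)) (fun v x => U (x + v)) _.
apply => x Ax.
have := @add_continuous G (x, 0); rewrite /continuous_at /= addr0; apply.
by apply: open_nbhs_nbhs; split => //; exact: AU.
Qed.

(** Neighbourhoods of 0 play the role of a uniformity. Base point and shift vary together in the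
    covering argument, so [f (y + v)] and [f y] are both compared with [f x]. *)
Lemma near_uniform_continuous {R : realType} (f : G -> R) (e : R) :
  compact [set: G] -> continuous f -> 0 < e ->
  \forall v \near (0 : G), forall x, `|f (x + v) - f x| < e.
Proof.
move=> /compact_near_coveringP cG cf e0.
have := cG G (nbhs (0 : G)) (fun v x => `|f (x + v) - f x| < e) _.
move=> H; suff: \forall v \near (0 : G), [set: G] `<=` (fun x => `|f (x + v) - f x| < e).
  by apply: filterS => v Hv x; exact: Hv.
apply: H => x _.
have h1 : \forall z \near ((x, 0) : G * G), `|f (z.1 + z.2) - f x| < e / 2.
  have := @add_continuous G (x, 0); rewrite /continuous_at /= addr0 => h.
  have /cvgrPdist_lt/(_ (e / 2)) := cf x; rewrite divr_gt0// => /(_ isT) h2.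
  have h3 : \forall z \near ((x, 0) : G * G), `|f x - f (z.1 + z.2)| < e / 2 := h _ h2.
  by apply: filterS h3 => z /=; rewrite distrC.
have h2 : \forall z \near ((x, 0) : G * G), `|f z.1 - f x| < e / 2.
  have /cvgrPdist_lt/(_ (e / 2)) := cf x; rewrite divr_gt0// => /(_ isT) h2.
  have h3 : \forall z \near ((x, 0) : G * G), `|f x - f z.1| < e / 2.
    exact: (@cvg_fst _ _ (nbhs x) (nbhs (0 : G)) _ _ h2).
  by apply: filterS h3 => z /=; rewrite distrC.
apply: filterS (filterI h1 h2) => -[y v] /= [A B].
rewrite (splitr e); apply: le_lt_trans (ltrD A B).
by rewrite [X in _ <= _ + X]distrC; apply: ler_distD.
Qed.

End topological_group.

(** * Haar measure of Borel sets and of continuous functions *)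

Section haar_measure.
Context {R : realType} {G : topologicalZmodType} (mu : probability (borel G) R).
Implicit Types (x y : G) (A B : set G).

Local Notation borel_measurable A := (measurable (A : set (borel G))).

Definition vol A : R := fine (mu A).

Lemma borel_open A : open A -> borel_measurable A.
Proof. by move=> oA; exact: sub_sigma_algebra. Qed.

Lemma borel_closed A : closed A -> borel_measurable A.
Proof.
by move=> cA; rewrite -(setCK A); apply: measurableC; apply: borel_open; exact: closed_openC.
Qed.

Lemma volE A : borel_measurable A -> mu A = (vol A)%:E.
Proof. by move=> mA; rewrite fineK// fin_num_measure. Qed.

Lemma vol_ge0 A : 0 <= vol A.
Proof. exact: fine_ge0. Qed.

Lemma vol_setT : vol setT = 1.
Proof. by rewrite /vol probability_setT. Qed.

Lemma vol_set0 : vol set0 = 0.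
Proof. by rewrite /vol measure0. Qed.

Lemma le_vol A B : borel_measurable A -> borel_measurable B -> A `<=` B -> vol A <= vol B.
Proof. by move=> mA mB AB; rewrite -lee_fin -!volE//; apply: le_measure => //; exact/mem_set. Qed.

Lemma vol_le1 A : borel_measurable A -> vol A <= 1.
Proof. by move=> mA; rewrite -vol_setT; apply: le_vol. Qed.

Lemma vol_setDI A B : borel_measurable A -> borel_measurable B ->
  vol A = vol (A `\` B) + vol (A `&` B).
Proof.
move=> mA mB; apply: EFin_inj; rewrite EFinD -!volE//; last 2 first.
- exact: measurableI.
- exact: measurableD.
exact: (measureDI mu mA mB).
Qed.

Lemma vol_setUI A B : borel_measurable A -> borel_measurable B ->
  vol (A `|` B) + vol (A `&` B) = vol A + vol B.
Proof.
move=> mA mB; have mAB := measurableU _ _ mA mB.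
have AUB : (A `|` B) `&` B = B by apply/setIidPr; exact: subsetUr.
rewrite (vol_setDI mAB mB) AUB setDUl setDv setU0 (vol_setDI mA mB); ring.
Qed.

Lemma vol_setC A : borel_measurable A -> vol (~` A) = 1 - vol A.
Proof. by move=> mA; apply: EFin_inj; rewrite -volE ?probability_setC ?volE//; exact: measurableC. Qed.

Lemma continuous_borel (f : G -> R) : continuous f -> measurable_fun [set: borel G] f.
Proof.
move=> /continuousP cf; apply: (measurability _ (RGenOpens.measurableE R)).
move=> _ [_ [a [b ->] <-]]; rewrite setTI; apply: borel_open; apply: cf.
exact: interval_open.
Qed.

Lemma translation_borel a : measurable_fun [set: borel G] (fun x : G => x + a : borel G).
Proof.
apply: (@measurability _ _ (borel G) (borel G) _ _ (@open G)) => // _ [U oU <-]; rewrite setTI.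
apply: borel_open; apply: open_comp => // x _; exact: translation_continuous.
Qed.

Hypotheses (cptG : compact [set: G]) (hausG : hausdorff_space G) (haar : is_haar mu).

Lemma borel_compact A : compact A -> borel_measurable A.
Proof. by move=> cA; apply: borel_closed; exact: compact_closed. Qed.

Lemma compact_of_closed A : closed A -> compact A.
Proof. by move=> cA; exact: (subclosed_compact cA cptG). Qed.

Lemma borel_translate A a : borel_measurable A -> borel_measurable [set x + a | x in A].
Proof.
move=> mA; rewrite (_ : [set _ | _ in _] = (fun x => x - a) @^-1` A); last first.
  apply/seteqP; split=> [_ [x Ax <-]|x /= Ax]; first by rewrite /= addrK.
  by exists (x - a) => //; rewrite subrK.
have : measurable_fun [set: borel G] (fun x : G => x - a : borel G).
  exact: translation_borel.
by move=> /(_ measurableT _ mA); rewrite setTI.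
Qed.

Lemma vol_translate A a : borel_measurable A -> vol [set x + a | x in A] = vol A.
Proof.
move=> mA; rewrite /vol -(haar_translation haar a mA); congr (fine (mu _)).
by apply: eq_imagel => x _; rewrite addrC.
Qed.

Lemma vol_outer A e : borel_measurable A -> 0 < e ->
  exists U, [/\ open U, A `<=` U & vol U < vol A + e].
Proof.
move=> mA e0.
have : (ereal_inf [set mu U | U in [set U : set G | open U /\ A `<=` U]] < (vol A + e)%:E)%E.
  by rewrite -haar_outer_regular// volE// lte_fin ltrDl.
move=> /ereal_inf_lt[_ [U [oU AU] <-]]; rewrite volE ?lte_fin; last exact: borel_open.
by move=> h; exists U.
Qed.

(** Complement of an outer approximation of the complement: it is closed, hence compact in a compact
    group. *)
Lemma vol_inner A e : borel_measurable A -> 0 < e ->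
  exists K, [/\ compact K, K `<=` A & vol A - e < vol K].
Proof.
move=> mA e0; have [U [oU AU h]] := vol_outer (measurableC mA) e0.
exists (~` U); split.
- by apply: compact_of_closed; exact: open_closedC.
- by rewrite -(setCK A); exact: subsetC.
- by move: h; rewrite !vol_setC//; [lra|exact: borel_open].
Qed.

Lemma continuous_bounded (f : G -> R) : continuous f ->
  exists2 M, 0 < M & forall x, `|f x| <= M.
Proof.
move=> cf; have : compact (range f).
  by apply: continuous_compact => //; exact: continuous_subspaceT.
move=> /compact_bounded [M [_ /(_ (`|M| + 1))]].
move=> H; exists (`|M| + 1) => [|x]; first by rewrite ltr_wpDl.
by apply: H; [rewrite (le_lt_trans (ler_norm _))// ltrDl|exists x].
Qed.

Lemma continuous_integrable (f : G -> R) : continuous f ->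
  mu.-integrable setT (EFin \o f).
Proof.
move=> cf; have [M M0 fM] := continuous_bounded cf.
apply: measurable_bounded_integrable => //.
- by rewrite -ge0_fin_numE// fin_num_measure.
- exact: continuous_borel.
- exists M; split; [exact: num_real|move=> x Mx y _ /=].
  exact: le_trans (fM y) (ltW Mx).
Qed.

Definition haar_int (f : G -> R) : R := \int[mu]_x f x.

Lemma haar_intD (f g : G -> R) : continuous f -> continuous g ->
  haar_int (fun x => f x + g x) = haar_int f + haar_int g.
Proof. by move=> cf cg; apply: RintegralD => //; exact: continuous_integrable. Qed.

Lemma haar_intB (f g : G -> R) : continuous f -> continuous g ->
  haar_int (fun x => f x - g x) = haar_int f - haar_int g.
Proof. by move=> cf cg; apply: RintegralB => //; exact: continuous_integrable. Qed.

Lemma haar_intZ r (f : G -> R) : continuous f -> haar_int (fun x => r * f x) = r * haar_int f.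
Proof. by move=> cf; apply: RintegralZl => //; exact: continuous_integrable. Qed.

Lemma haar_int_cst r : haar_int (fun=> r) = r.
Proof. by rewrite /haar_int Rintegral_cst// -/(vol _) vol_setT mulr1. Qed.

Lemma le_haar_int (f g : G -> R) : continuous f -> continuous g -> (forall x, f x <= g x) ->
  haar_int f <= haar_int g.
Proof. by move=> cf cg fg; apply: le_Rintegral => //; exact: continuous_integrable. Qed.

Lemma haar_int_ge0 (f : G -> R) : (forall x, 0 <= f x) -> 0 <= haar_int f.
Proof. by move=> f0; apply: Rintegral_ge0. Qed.

Lemma haar_int_translate (f : G -> R) a : continuous f ->
  haar_int (fun x => f (x + a)) = haar_int f.
Proof.
move=> cf; rewrite /haar_int /Rintegral; congr fine.
have mt : measurable_fun [set: borel G] (fun x : G => x + a : borel G).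
  exact: translation_borel.
have := @integral_pushforward _ _ (borel G) (borel G) R _ mt mu setT (EFin \o f).
rewrite preimage_setT => <- //; last 2 first.
- by apply/measurable_EFinP; exact: continuous_borel.
- apply: (continuous_integrable (f := fun x => f (x + a))).
  exact: continuous_translate.
apply: eq_measure_integral => A mA _.
rewrite /pushforward -[LHS](haar_translation haar a); last first.
  by have := mt measurableT _ mA; rewrite setTI.
congr (mu _); apply/seteqP; split => [_ [x Ax <-]|x Ax]; first by rewrite addrC.
by exists (x - a); rewrite /= ?subrK// addrC subrK.
Qed.

(** Serves to integrate the finite averages of [haar_average] term by term. *)
Lemma haar_int_lincomb (l : seq (R * G)) (F : G -> G -> R) :
  (forall y, continuous (F y)) ->
  continuous (fun x => \sum_(p <- l) p.1 * F p.2 x) /\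
  haar_int (fun x => \sum_(p <- l) p.1 * F p.2 x) =
    \sum_(p <- l) p.1 * haar_int (F p.2).
Proof.
move=> cF; elim: l => [|[w y] l [IHc IH]].
  split; first by move=> x; under eq_fun do rewrite big_nil; exact: cvg_cst.
  by under eq_fun do rewrite big_nil; rewrite haar_int_cst big_nil.
under eq_fun do rewrite big_cons /=.
have cwF : continuous (fun x => w * F y x) by move=> x; apply: cvgMr; exact: cF.
split; first by move=> x; apply: cvgD; [exact: cwF|exact: IHc].
by rewrite haar_intD// IH big_cons haar_intZ.
Qed.

End haar_measure.

(** * Averaging, reflection invariance, full support *)

Section haar_average.
Context {R : realType} {G : topologicalZmodType} (mu : probability (borel G) R).
Implicit Types (x y : G) (A B : set G).
Hypotheses (cptG : compact [set: G]) (hausG : hausdorff_space G) (haar : is_haar mu).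

Local Notation vol := (vol mu).
Local Notation haar_int := (haar_int mu).

(* Partitioning D into small pieces, one inside each translate [y + V], y in s. *)
Lemma haar_average_on (f : G -> R) (V : set G) (e : R) (s : seq G) (D : set G) :
  continuous f -> open V -> (forall v, V v -> forall x, `|f (x + v) - f x| < e) ->
  measurable (D : set (borel G)) -> (forall z, D z -> exists2 y, y \in s & V (z - y)) ->
  exists l : seq (R * G), [/\ forall p, p \in l -> 0 <= p.1,
    \sum_(p <- l) p.1 = vol D &
    forall x, `|\int[mu]_(y in D) f (y + x) - \sum_(p <- l) p.1 * f (p.2 + x)| <= e * vol D].
Proof.
move=> cf oV fV; elim: s D => [|y s IH] D mD Ds.
  have -> : D = set0 by apply/seteqP; split=> // z /Ds[].
  exists [::]; split => //; first by rewrite big_nil vol_set0.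
  by move=> x; rewrite big_nil Rintegral_set0 subr0 normr0 vol_set0 mulr0.
pose V' := [set z | V (z - y)].
have mV' : measurable (V' : set (borel G)).
  by apply: borel_open; apply: open_comp oV => z _; exact: translation_continuous.
have mD1 : measurable (D `&` V' : set (borel G)) by exact: measurableI.
have mD2 : measurable (D `\` V' : set (borel G)) by exact: measurableD.
have [|l [l0 lD lf]] := IH _ mD2.
  move=> z [/Ds[w]]; rewrite inE => /orP[/eqP -> //|ws] Vw _; by exists w.
exists ((vol (D `&` V'), y) :: l); split.
- by move=> p; rewrite inE => /orP[/eqP -> /=|/l0//]; exact: vol_ge0.
- by rewrite big_cons lD /= addrC -vol_setDI.
move=> x; rewrite big_cons /=.
have intf E : measurable (E : set (borel G)) -> mu.-integrable E (EFin \o (fun y => f (y + x))).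
  move=> mE; apply: (@integrableS _ _ _ mu setT) => //.
  by apply: continuous_integrable => //; exact: continuous_translate.
have DE : D = (D `\` V') `|` (D `&` V') by rewrite setUC setUIDK.
have -> : \int[mu]_(y in D) f (y + x) =
    \int[mu]_(y in D `\` V') f (y + x) + \int[mu]_(y in D `&` V') f (y + x).
  rewrite {1}DE Rintegral_setU//.
  - by rewrite -DE; exact: intf.
  - by apply/disj_setPS => z [[_ nV] [_ /nV]].
rewrite (_ : _ - _ = (\int[mu]_(y in D `\` V') f (y + x) - \sum_(j <- l) j.1 * f (j.2 + x))
   + (\int[mu]_(y in D `&` V') f (y + x) - vol (D `&` V') * f (y + x))); last by ring.
apply: le_trans (ler_normD _ _) _.
rewrite (vol_setDI mu mD mV') mulrDr lerD//.
have -> : vol (D `&` V') * f (y + x) = \int[mu]_(z in D `&` V') f (y + x).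
  by rewrite Rintegral_cst// mulrC.
have icst r : mu.-integrable (D `&` V' : set (borel G)) (EFin \o fun=> r).
  apply: (@integrableS _ _ _ mu setT) => //.
  by apply: continuous_integrable => // z; exact: cvg_cst.
rewrite -RintegralB//; last exact: intf.
apply: le_trans (le_normr_Rintegral _ _) _ => //.
  have := integrableB mD1 (intf _ mD1) (icst (f (y + x))).
  by apply: eq_integrable => // z _.
rewrite [e * _](_ : _ = \int[mu]_(z in D `&` V') e); last by rewrite Rintegral_cst.
apply: le_Rintegral => //.
  have := integrable_abse (integrableB mD1 (intf _ mD1) (icst (f (y + x)))).
  by apply: eq_integrable => // z _.
move=> z [_ /= /fV]; move=> /(_ (y + x)) /ltW; congr (`|f _ - _| <= _).
by rewrite (addrC y) -addrA [y + _]addrC subrK addrC.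
Qed.

(** A Riemann sum valid for all [x] at once, because the modulus of continuity is translation
    invariant. It takes the place of Fubini's theorem: double integrals become finite sums of
    integrals. *)
Lemma haar_average (f : G -> R) (e : R) : continuous f -> 0 < e ->
  exists l : seq (R * G), [/\ forall p, p \in l -> 0 <= p.1,
    \sum_(p <- l) p.1 = 1 &
    forall x, `|haar_int f - \sum_(p <- l) p.1 * f (p.2 + x)| <= e].
Proof.
move=> cf e0.
have /nbhs_interior := near_uniform_continuous cptG cf e0.
set V := (X in nbhs _ X) => nV.
have oV : open V by exact: open_interior.
have fV v : V v -> forall x, `|f (x + v) - f x| < e by move=> /interior_subset.
move: cptG; rewrite compact_cover => /(_ G setT (fun y => [set z | V (z - y)])).
case=> [y _||D _ DT].
- by apply: open_comp oV => z _; exact: translation_continuous.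
- by move=> z _; exists z => //=; rewrite subrr; exact: nbhs_singleton.
have [//|z _|l [l0 l1 lf]] :=
    haar_average_on (s := enum_fset D) (D := setT) cf oV fV.
  by have [y yD] := DT z I; exists y.
exists l; split => //; first by rewrite l1 vol_setT.
move=> x; have := lf x; rewrite vol_setT mulr1; congr (`|_ - _| <= e).
exact: haar_int_translate.
Qed.

(** The finite average [S] is integrated in two ways: it is uniformly within [e] of [haar_int f],
    and each of its terms is a weighted translate of [x |-> f (a - x)]. *)
Lemma haar_int_reflect (f : G -> R) a : continuous f ->
  haar_int (fun x => f (a - x)) = haar_int f.
Proof.
move=> cf; have cfN c : continuous (fun x => f (c - x)).
  by move=> x; apply: continuous_comp; [exact: reflection_continuous|exact: cf].
suff h (e : R) : 0 < e -> `|haar_int f - haar_int (fun x => f (a - x))| <= e.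
  apply/eqP; rewrite eq_sym -subr_eq0 -normr_eq0 eq_le normr_ge0 andbT.
  by apply/ler_addgt0Pl => e /h; rewrite addr0.
move=> e0; have [l [l0 l1 lf]] := haar_average cf e0.
pose S x := \sum_(p <- l) p.1 * f (p.2 + (a - x)).
have cfy y : continuous (fun x => f (y + (a - x))).
  by move=> x; under eq_fun do rewrite addrA; exact: cfN.
have [cS] := haar_int_lincomb mu cptG l cfy; rewrite -/S.
under eq_bigr => p _.
  rewrite (_ : haar_int _ = haar_int (fun x => f (a - x))); first over.
  rewrite -[RHS](haar_int_translate cptG haar (- p.2)); last exact: cfN.
  by congr (haar_int _); apply/funext => x; rewrite opprB addrCA addrC.
rewrite -mulr_suml l1 mul1r => SI.
rewrite -SI -(haar_int_cst mu (haar_int f)) -haar_intB//; last by move=> x; exact: cvg_cst.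
have cfS : continuous (fun x => haar_int f - S x).
  by move=> x; apply: cvgB; [exact: cvg_cst|exact: cS].
rewrite ler_norml -[X in X <= _ <= _](haar_int_cst mu) -[X in _ <= _ <= X](haar_int_cst mu).
by apply/andP; split; apply: le_haar_int => //; try (by move=> x; exact: cvg_cst);
  move=> x; have := lf (a - x); rewrite ler_norml => /andP[].
Qed.

Lemma continuous_between (K U : set G) : compact K -> open U -> K `<=` U ->
  exists f : G -> R, [/\ continuous f, forall x, 0 <= f x <= 1,
    forall x, K x -> f x = 1 & forall x, ~ U x -> f x = 0].
Proof.
move=> cK oU KU.
have /normal_separatorP sep := compact_normal hausG cptG.
have UK0 : ~` U `&` K = set0 by apply/seteqP; split => // x [nU /KU].
have /(@uniform_separatorP _ R)[f [cf f01 f0 f1]] :=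
  sep R _ _ (open_closedC oU) (compact_closed hausG cK) UK0.
exists f; split => // x.
- by have := f01 (f x); rewrite /= in_itv /=; apply; exists x.
- by move=> Kx; apply: f1; exists x.
- by move=> nU; apply: f0; exists x.
Qed.

Lemma vol_le_haar_int (A : set G) (f : G -> R) : measurable (A : set (borel G)) ->
  continuous f -> (forall x, 0 <= f x) -> (forall x, A x -> 1 <= f x) -> vol A <= haar_int f.
Proof.
move=> mA cf f0 f1; rewrite -[vol A]mul1r -Rintegral_cst//.
apply: (@le_trans _ _ (\int[mu]_(x in A) f x)).
  apply: le_Rintegral => //; apply: (@integrableS _ _ _ mu setT) => //.
  - by apply: continuous_integrable => // z; exact: cvg_cst.
  - exact: continuous_integrable.
rewrite /haar_int Rintegral_mkcond; apply: le_Rintegral => //.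
- have := continuous_integrable mu cptG cf.
  by move=> /(integrableS measurableT mA (@subsetT _ _))/(integrable_mkcond _ mA); rewrite restrict_EFin.
- exact: continuous_integrable.
- by move=> x _; rewrite patchE; case: ifP.
Qed.

Lemma haar_int_le_vol (A : set G) (f : G -> R) : measurable (A : set (borel G)) ->
  continuous f -> (forall x, f x <= 1) -> (forall x, ~ A x -> f x <= 0) -> haar_int f <= vol A.
Proof.
move=> mA cf f1 f0; have cf' : continuous (fun x => 1 - f x).
  by move=> x; apply: cvgB; [exact: cvg_cst|exact: cf].
have := @vol_le_haar_int (~` A) (fun x => 1 - f x) (measurableC mA) cf'.
rewrite vol_setC// haar_intB// ?haar_int_cst; last by move=> x; exact: cvg_cst.
move=> H; have : 1 - vol A <= 1 - haar_int f by apply: H => x; [rewrite subr_ge0|move=> /f0; lra].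
lra.
Qed.

(** An Urysohn function squeezed between [K] and an open set of almost the same measure transfers
    [haar_int_reflect] to sets, as an inequality. Reflection being an involution, the inequality for
    the reflected set is the converse. *)
Lemma vol_reflect (K : set G) a : compact K -> vol [set a - x | x in K] = vol K.
Proof.
have le1 (K' : set G) : compact K' -> vol [set a - x | x in K'] <= vol K'.
  move=> cK; apply/ler_addgt0Pl => e e0; rewrite addrC.
  have mK := borel_compact hausG cK.
  have [U [oU KU /ltW]] := vol_outer haar mK e0; apply: le_trans.
  have [f [cf f01 f1 f0]] := continuous_between cK oU KU.
  apply: (@le_trans _ _ (haar_int f)).
    rewrite -(haar_int_reflect a cf); apply: vol_le_haar_int.
    - by apply: borel_compact => //; exact: compact_reflect.
    - by move=> x; apply: continuous_comp; [exact: reflection_continuous|exact: cf].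
    - by move=> x; have /andP[] := f01 (a - x).
    - by move=> _ [x Kx <-]; rewrite subKr f1.
  apply: haar_int_le_vol => // [|x|x].
  - exact: borel_open.
  - by have /andP[] := f01 x.
  - by move=> /f0 ->.
move=> cK; apply/eqP; rewrite eq_le le1//=.
rewrite [X in vol X <= _](_ : K = [set a - x | x in [set a - x | x in K]]).
  by apply: le1; exact: compact_reflect.
apply/seteqP; split => [x Kx|_ [_ [x Kx <-] <-]]; last by rewrite subKr.
by exists (a - x); [exists x|rewrite subKr].
Qed.

(** Finitely many translates of [U] cover the group; were [U] null, the group would be null. *)
Lemma vol_open_gt0 (U : set G) : open U -> U !=set0 -> 0 < vol U.
Proof.
move=> oU [u Uu]; rewrite lt_neqAle vol_ge0 andbT; apply/eqP => U0.
move: cptG; rewrite compact_cover => /(_ G setT (fun a => [set x + a | x in U])).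
have oUa a : open [set x + a | x in U].
  rewrite (_ : [set _ | _ in _] = (fun x => x - a) @^-1` U); last first.
    apply/seteqP; split=> [_ [x Ax <-]|x /= Ax]; first by rewrite /= addrK.
    by exists (x - a) => //; rewrite subrK.
  by apply: open_comp oU => x _; exact: translation_continuous.
case=> [//|x _|D _ DT].
  by exists (x - u) => //; exists u => //; rewrite addrC subrK.
have : vol (\big[setU/set0]_(a <- enum_fset D) [set x + a | x in U]) = 0.
  elim: (enum_fset D) => [|a s IH]; first by rewrite big_nil vol_set0.
  have mU c : measurable ([set x + c | x in U] : set (borel G)) by apply: borel_open.
  have mB : measurable (\big[setU/set0]_(a <- s) [set x + a | x in U] : set (borel G)).
    exact: bigsetU_measurable.
  rewrite big_cons; apply/eqP; rewrite eq_le vol_ge0 andbT.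
  have := vol_setUI mu (mU a) mB; rewrite IH vol_translate// -?U0; last exact: borel_open.
  have := vol_ge0 mu ([set x + a | x in U] `&` (\big[setU/set0]_(a <- s) [set x + a | x in U])).
  lra.
rewrite (_ : \big[setU/set0]_(a <- _) _ = setT) ?vol_setT; last first.
  apply/seteqP; split=> // x _; have [a aD Ux] := DT x I.
  by rewrite -bigcup_seq; exists a.
by move/eqP; rewrite oner_eq0.
Qed.

(** Markov's inequality on the open set where [f] exceeds half of a positive value, which has
    positive measure. *)
Lemma haar_int_eq0 (f : G -> R) : continuous f -> (forall x, 0 <= f x) ->
  haar_int f = 0 -> forall x, f x = 0.
Proof.
move=> cf f0 If x; apply/eqP; rewrite eq_le f0 andbT leNgt; apply/negP => fx.
pose U := [set y | f x / 2 < f y].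
have oU : open U.
  rewrite (_ : U = f @^-1` [set r | f x / 2 < r])//.
  by apply: open_comp; [move=> y _; exact: cf|exact: open_gt].
have : 0 < vol U by apply: vol_open_gt0 => //; exists x; rewrite /U /=; lra.
have : vol U <= haar_int (fun y => (2 / f x) * f y).
  apply: vol_le_haar_int.
  - exact: borel_open.
  - by move=> y; apply: cvgMr; exact: cf.
  - by move=> y; rewrite mulr_ge0// divr_ge0// ltW.
  - by move=> y; rewrite /U /= => h; rewrite mulrAC ler_pdivlMr// mul1r; lra.
rewrite haar_intZ// If mulr0; lra.
Qed.

End haar_average.

(** * Kneser's inequality *)

Section kneser.
Context {R : realType} {G : topologicalZmodType} (mu : probability (borel G) R).
Implicit Types (x y : G) (A B : set G).
Hypotheses (cptG : compact [set: G]) (hausG : hausdorff_space G) (haar : is_haar mu).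

Local Notation vol := (vol mu).
Local Notation haar_int := (haar_int mu).
Local Notation translate A a := [set x + a | x in A].

(** Pigeonhole: [K] and [x - L] have total measure above 1, so they meet. *)
Lemma sumset_setT (K L : set G) : compact K -> compact L -> 1 < vol K + vol L ->
  sumset K L = setT.
Proof.
move=> cK cL KL; apply/seteqP; split=> // x _; apply: contrapT => nx.
have cL' := compact_reflect (a := x) cL.
have mL' := borel_compact hausG cL'; have mK := borel_compact hausG cK.
have := vol_setUI mu mK mL'.
rewrite (_ : K `&` _ = set0) ?vol_set0 ?vol_reflect//; last first.
  apply/seteqP; split=> // z [Kz [l Ll lz]]; apply: nx.
  by exists z => //; exists l => //; rewrite -lz subrK.
have := vol_le1 mu (measurableU _ _ mK mL').
lra.
Qed.

(** * Overlap of a compact set with its translates *)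

Section overlap.
Variable A : set G.
Hypothesis cA : compact A.

Let borelA x : measurable (translate A x : set (borel G)).
Proof. by apply: borel_compact => //; exact: compact_translate. Qed.

Let mA : measurable (A : set (borel G)). Proof. exact: borel_compact. Qed.

(** The autocorrelation of the indicator function of [A]. *)
Definition overlap x : R := vol (A `&` translate A x).

Lemma overlap0 : overlap 0 = vol A.
Proof.
rewrite /overlap; congr vol; rewrite (_ : translate A 0 = A) ?setIid//.
by under eq_imagel do rewrite addr0; rewrite image_id.
Qed.

Lemma translateD B x y : translate (translate B x) y = translate B (x + y).
Proof. by rewrite image_comp; apply: eq_imagel => z _ /=; rewrite addrA. Qed.

Lemma translate_setI B C x : translate (B `&` C) x = translate B x `&` translate C x.
Proof.
apply/seteqP; split=> [_ [y [By Cy] <-]|_ [[y By <-] [z Cz /addIr zy]]].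
  by split; exists y.
by exists y => //; split => //; rewrite -zy.
Qed.

Lemma overlapN x : overlap (- x) = overlap x.
Proof.
rewrite /overlap -(vol_translate haar x); last exact: measurableI.
rewrite translate_setI translateD addNr setIC.
by under [in translate A 0]eq_imagel do rewrite addr0; rewrite image_id.
Qed.

(** What is lost from [A + x] to [A + x + v] lies in their difference, whose measure does not depend
    on [x]. Continuity of [overlap] is thus reduced to continuity at 0. *)
Lemma overlap_sub x v : overlap x - overlap (x + v) <= vol A - overlap v.
Proof.
have -> : overlap v = vol (translate A x `&` translate A (x + v)).
  rewrite addrC -translateD -translate_setI vol_translate//; exact: measurableI.
rewrite -(vol_translate haar x mA).
rewrite [X in _ <= X - _](vol_setDI mu (borelA x) (borelA (x + v))) addrK.
rewrite lerBlDr /overlap.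
have mI := measurableI _ _ mA (borelA x).
rewrite (vol_setDI mu mI (borelA (x + v))) lerD//.
- by apply: le_vol; [exact: measurableD|exact: measurableD|apply: setSD; exact: subIsetr].
- apply: le_vol; [exact: measurableI|exact: measurableI|].
  by move=> z [[Az _] xz].
Qed.

(** For [v] near 0 the translate [A + v] stays inside an open [U] barely larger than [A]. *)
Lemma overlap_near0 (e : R) : 0 < e -> \forall v \near (0 : G), vol A - overlap v < e.
Proof.
move=> e0; have [U [oU AU Ue]] := vol_outer haar mA e0.
apply: filterS (near_translate_sub cA oU AU) => v AvU.
have mU := borel_open oU.
rewrite -(vol_translate haar v mA) (vol_setDI mu (borelA v) mA) /overlap.
rewrite [_ `&` A]setIC addrK; apply: (@le_lt_trans _ _ (vol (U `\` A))).
  apply: le_vol; [exact: measurableD|exact: measurableD|].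
  by apply: setSD => _ [x Ax <-]; exact: AvU.
have := vol_setDI mu mU mA; rewrite (_ : U `&` A = A); last exact/setIidPr.
lra.
Qed.

Lemma overlap_continuous : continuous overlap.
Proof.
move=> x; apply/cvgrPdist_lt => e e0.
have c0 : (fun x' => x' - x) @ x --> (0 : G).
  by rewrite -(subrr x); exact: translation_continuous.
have h : \forall x' \near x, vol A - overlap (x' - x) < e by exact: c0 _ (overlap_near0 e0).
apply: filterS h => x' h; rewrite ltr_norml; apply/andP; split.
- have := overlap_sub x' (x - x'); rewrite [x' + _]addrC subrK -(overlapN (x - x')) opprB; lra.
- have := overlap_sub x (x' - x); rewrite [x + _]addrC subrK; lra.
Qed.

(* The mean of [overlap] over G is [vol A ^+ 2]. *)
Lemma overlap_small (e : R) : 0 < e -> exists x, overlap x < vol A ^+ 2 + e.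
Proof.
move=> e0.
have a0 := vol_ge0 mu A; have a1 := vol_le1 mu mA.
(* The final estimate is [(a + 2 d) (a + d) <= a^2 + 5 d] for [a = vol A] and [a, d <= 1], and
   [5 d < e]. *)
pose d := Num.min 1 (e / 8).
have d0 : 0 < d by rewrite lt_min ltr01 divr_gt0.
have d1 : d <= 1 by rewrite ge_min lexx.
have de : d * 8 <= e by rewrite -ler_pdivlMr// ge_min lexx orbT.
have [U [oU AU Ue]] := vol_outer haar mA d0.
have [g [cg g01 g1 g0]] := continuous_between (R := R) cptG hausG cA oU AU.
have g_ge0 x : 0 <= g x by have /andP[] := g01 x.
have g_le1 x : g x <= 1 by have /andP[] := g01 x.
have Ig : haar_int g <= vol A + d.
  apply: le_trans (ltW Ue); apply: haar_int_le_vol => //; first exact: borel_open.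
  by move=> x /g0 ->.
have Ig0 : 0 <= haar_int g by exact: haar_int_ge0.
have [l [l0 l1 lg]] := haar_average cptG haar cg d0.
apply: contrapT => /forallNP nx.
have cgy y : continuous (fun x => g (y + x)).
  have -> : (fun x => g (y + x)) = (fun x => g (x + y)) by apply/funext => x; rewrite addrC.
  exact: continuous_translate.
have cgg y : continuous (fun x => g x * g (y + x)).
  by move=> x; apply: cvgM; [exact: cg|exact: cgy].
have [cS IS] := haar_int_lincomb mu cptG l cgg.
(* The averaged autocorrelation of [g] is bounded below by the overlaps, since [g] dominates the
   indicator of [A], and above by pulling out the almost constant average of the translates of
   [g]. *)
have : vol A ^+ 2 + e <= \sum_(p <- l) p.1 * haar_int (fun x => g x * g (p.2 + x)).
  rewrite -[leLHS]mul1r -l1 mulr_suml big_seq [leRHS]big_seq; apply: ler_sum => p pl.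
  apply: ler_wpM2l; first exact: l0.
  apply: (@le_trans _ _ (overlap (- p.2))); first by rewrite leNgt; apply/negP/nx.
  apply: vol_le_haar_int => //; first exact: measurableI.
  - by move=> x; rewrite mulr_ge0.
  - by move=> z [Az [x Ax xz]]; rewrite g1// -xz addrC subrK g1// mulr1.
rewrite -IS => lo.
have : haar_int (fun x => \sum_(p <- l) p.1 * (g x * g (p.2 + x))) <=
    haar_int (fun x => (vol A + d + d) * g x).
  apply: le_haar_int => // [x|x]; first by apply: cvgMr; exact: cg.
  rewrite (_ : \sum_(p <- l) _ = g x * \sum_(p <- l) p.1 * g (p.2 + x)); last first.
    by rewrite mulr_sumr; apply: eq_bigr => p _; rewrite mulrCA.
  rewrite mulrC ler_wpM2r//; have := lg x; rewrite ler_norml => /andP[]; lra.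
rewrite haar_intZ// => hi.
have : (vol A + d + d) * haar_int g <= (vol A + d + d) * (vol A + d).
  by apply: ler_wpM2l => //; lra.
nra.
Qed.

Hypothesis connG : connected [set: G].

(** Intermediate values between [vol A], reached at 0, and a value close to the mean. *)
Lemma overlap_surj (d : R) : 0 <= d -> vol A ^+ 2 < vol A - d ->
  exists x, overlap x = vol A - d.
Proof.
move=> d0 dA; have e0 : 0 < vol A - d - vol A ^+ 2 by lra.
have [y yl] := overlap_small e0.
have : connected (range overlap).
  apply: connected_continuous_connected => //; apply: continuous_subspaceT.
  exact: overlap_continuous.
move=> /connected_intervalP /(_ (overlap y) (overlap 0)) /(_ _ _ (vol A - d)).
case=> [||| x _ <-]; [by exists y|by exists 0| |by exists x].
by rewrite overlap0; apply/andP; split; lra.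
Qed.

End overlap.

Lemma sumset_translate A B x : sumset (translate A x) B = translate (sumset A B) x.
Proof.
apply/seteqP; split=> [_ [_ [a Aa <-] [b Bb <-]]|_ [_ [a Aa [b Bb <-]] <-]].
  by exists (a + b); [exists a => //; exists b|rewrite addrAC].
by exists (a + x); [exists a|exists b => //; rewrite addrAC].
Qed.

Lemma sumsetC A B : sumset A B = sumset B A.
Proof.
by apply/seteqP; split=> _ [a Aa [b Bb <-]]; exists b => //; exists a => //; rewrite addrC.
Qed.

Lemma vol_sumset_ge A B : compact A -> compact B -> B !=set0 -> vol A <= vol (sumset A B).
Proof.
move=> cA cB [b Bb]; have mA := borel_compact hausG cA.
rewrite -(vol_translate haar b mA); apply: le_vol.
- exact: borel_translate.
- by apply: borel_compact => //; exact: compact_sumset.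
- by move=> _ [x Ax <-]; exists x => //; exists b.
Qed.

(** The sumset of a union is the union of the sumsets, that of an intersection lies in their
    intersection; [vol] is modular. *)
Lemma sumset_submodular A A' B : compact A -> compact A' -> compact B ->
  vol (sumset (A `&` A') B) + vol (sumset (A `|` A') B) <=
  vol (sumset A B) + vol (sumset A' B).
Proof.
move=> cA cA' cB.
have mS C : compact C -> measurable (sumset C B : set (borel G)).
  by move=> cC; apply: borel_compact => //; exact: compact_sumset.
rewrite -(vol_setUI mu (mS _ cA) (mS _ cA')) addrC; apply: lerD; apply: le_vol.
- by apply: mS; exact: compactU.
- by apply: measurableU; exact: mS.
- by move=> _ [x [Ax|Ax] [b Bb <-]]; [left|right]; exists x => //; exists b.
- by apply: mS; apply: compact_closedI => //; exact: compact_closed.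
- by apply: measurableI; exact: mS.
- by move=> _ [x [Ax Ax'] [b Bb <-]]; split; exists x => //; exists b.
Qed.

Hypothesis connG : connected [set: G].

(* Kneser's theorem for connected groups, by descent on the submodular
   functional [vol (A + B) - vol A]: shifting A to a nearby translate trades A
   for [A `&` (A + x)] and [A `|` (A + x)], of measures [vol A -+ d]. *)
Theorem kneser A B : compact A -> compact B -> A !=set0 -> B !=set0 ->
  vol A + vol B <= 1 -> vol A + vol B <= vol (sumset A B).
Proof.
move=> cA cB A0 B0 AB1; rewrite leNgt; apply/negP => AB.
have vA0 : 0 < vol A.
  rewrite lt_neqAle vol_ge0 andbT; apply/negP => /eqP vA.
  by have := vol_sumset_ge cB cA A0; rewrite sumsetC leNgt => /negP; apply; rewrite -vA add0r in AB.
pose f C := vol (sumset C B) - vol C.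
pose dom C := [/\ compact C, 0 < vol C & vol C + vol B <= 1].
have domA : dom A by [].
have f0 C : compact C -> 0 <= f C.
  by move=> cC; rewrite subr_ge0; exact: vol_sumset_ge.
have fB C : dom C -> vol B - vol C <= f C.
  case=> cC C0 _; rewrite lerD2r sumsetC; apply: vol_sumset_ge => //.
  by apply/set0P; apply: contraPneq C0 => ->; rewrite vol_set0 ltxx.
pose S := [set f C | C in dom].
have S0 : S !=set0 by exists (f A); exists A.
have lS : has_lbound S by exists 0 => _ [C [cC _ _] <-]; exact: f0.
(* The infimum is not known to be attained, so the descent starts from a near-minimizer. *)
pose m := inf S.
have mf C : dom C -> m <= f C by move=> dC; apply: ge_inf => //; exists C.
have m0 : 0 <= m by apply: lb_le_inf => // _ [C [cC _ _] <-]; exact: f0.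
(* Positive because the assumed failure of the inequality says [f A < vol B]. *)
pose k := vol B - m.
have k0 : 0 < k by rewrite subr_gt0; apply: le_lt_trans (mf _ domA) _; rewrite /f; lra.
have b0 : 0 < vol B by rewrite /k in k0; lra.
have b1 : vol B < 1 by lra.
(* One step size for all [C]. As long as [f C - m < k / 2], one has [vol C > k / 2], hence
   [vol C * (1 - vol C) > 2 d], and a translate losing exactly [d] exists. *)
pose d := k * vol B / 4.
have d0 : 0 < d by rewrite divr_gt0// mulr_gt0.
have dk : d < k / 4 by rewrite ltr_pM2r// gtr_pMr.
have step C : dom C -> f C - m < k / 2 -> exists C',
    [/\ dom C', vol C' = vol C - d & f C' - m <= 2 * (f C - m)].
  move=> dC fC; have [cC C0 C1] := dC; have kC := fB _ dC.
  have Ck : k / 2 < vol C by rewrite /k in fC kC *; lra.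
  have dC2 : vol C ^+ 2 < vol C - d.
    have h1 : 0 < (vol C - k / 2) * vol B by rewrite mulr_gt0//; lra.
    have h2 : 0 <= vol C * (1 - vol C - vol B) by rewrite mulr_ge0//; lra.
    rewrite /d; nra.
  have [x xC] := overlap_surj cC connG (ltW d0) dC2.
  have cCx := compact_translate (a := x) cC.
  have mC := borel_compact hausG cC; have mCx := borel_compact hausG cCx.
  have cI : compact (C `&` translate C x) by apply: compact_closedI => //; exact: compact_closed.
  have cU := compactU cC cCx.
  have vU : vol (C `|` translate C x) = vol C + d.
    have := vol_setUI mu mC mCx; rewrite -/(overlap C x) xC vol_translate//; lra.
  have dI : dom (C `&` translate C x).
    by split => //; rewrite -/(overlap C x) xC; lra.
  exists (C `&` translate C x); split => //.
  (* If the union leaves the domain, its sumset is the whole group, and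
     [1 - vol C - d >= vol B - d > m]. By submodularity the intersection then has at most twice the
     excess of [C] over [m]. *)
  have fU : m <= f (C `|` translate C x).
    have [h|h] := leP (vol C + d + vol B) 1.
      by apply: mf; split => //; rewrite vU//; lra.
    by rewrite /f sumset_setT ?vU// ?vol_setT; rewrite /k in dk; lra.
  have := sumset_submodular cC cCx cB.
  rewrite sumset_translate vol_translate//; last first.
    by apply: borel_compact => //; exact: compact_sumset.
  move: fU; rewrite /f vU -/(overlap C x) xC; lra.
(* The excess at most doubles at each step, so a start within [k / 2 / 2 ^+ n] of [m] allows [n]
   steps, each removing [d] from the volume. This is absurd once [n * d] exceeds 1. *)
have iter n C : dom C -> f C - m < k / 2 / 2 ^+ n -> n%:R * d < vol C.
  elim: n C => [|n IH] C dC fC; first by rewrite mul0r; case: dC.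
  have fC2 : (f C - m) * 2 < k / 2 / 2 ^+ n.
    by move: fC; rewrite exprS invfM mulrA; lra.
  have [|C' [dC' vC' fC']] := step C dC.
    apply: lt_le_trans fC _; rewrite ler_pdivrMr ?exprn_gt0//.
    by rewrite ler_pMr ?divr_gt0// exprn_ege1// ler1n.
  have := IH C' dC'; rewrite vC' -[n.+1%:R]natr1 => H.
  have : n%:R * d < vol C - d by apply: H; lra.
  lra.
pose n := Num.truncn (d^-1).
have [_ [C dC <-] fC] : exists2 y, S y & y < m + k / 2 / 2 ^+ n.+1.
  have h : 0 < k / 2 / 2 ^+ n.+1 by rewrite !divr_gt0// exprn_gt0.
  by have [y Sy yl] := inf_adherent h (conj S0 lS); exists y.
have := iter n.+1 C dC; rewrite ltrBlDl => /(_ fC).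
have mC : vol C <= 1 by case: dC => cC _ _; apply: vol_le1; exact: borel_compact.
have : 1 < n.+1%:R * d by rewrite -ltr_pdivrMr// mul1r; exact: truncnS_gt.
lra.
Qed.

End kneser.

(** * Minimal functions *)

Section gomory_johnson.
Context {R : realType} {G : zmodType} (b : G).
Implicit Types (s : seq G) (pi : G -> R).

Lemma fsbig_count {V : nmodType} s (F : G -> V) :
  \sum_(x \in [set: G]) F x *+ count_mem x s = \sum_(x <- s) F x.
Proof.
rewrite (fsbigE (undup s)) ?undup_uniq//; last first.
  by move=> x _; rewrite mem_undup => /count_memPn ->.
rewrite -(big_undup_iterop_count +%R s xpredT).
by apply: eq_bigl => x; rewrite in_setT.
Qed.

Lemma fsbig_multiset (y : G -> nat) : finite_set [set x | y x != 0%N] ->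
  exists s, forall (V : nmodType) (F : G -> V),
    \sum_(x \in [set: G]) F x *+ y x = \sum_(x <- s) F x.
Proof.
move=> fy; pose r := enum_fset (fset_set [set x | y x != 0%N]).
exists (flatten [seq nseq (y x) x | x <- r]) => V F.
rewrite big_flatten big_map (fsbigE r) ?fset_uniq//; last first.
  move=> x _; rewrite /r (in_fset_set fy) notin_setE /= => /negP.
  by rewrite negbK => /eqP ->.
rewrite [LHS](eq_bigl xpredT); last by move=> x; rewrite in_setT.
apply: eq_bigr => x _; rewrite big_nseq.
by elim: (y x) => [|n IH]; rewrite ?mulr0n// mulrS IH.
Qed.

(** Finitely supported multiplicity functions are traded for lists with repetitions, on which one
    can do induction and surgery. *)
Lemma valid_seqP pi : valid b pi <-> (forall x, 0 <= pi x) /\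
  forall s, \sum_(x <- s) x = b -> 1 <= \sum_(x <- s) pi x.
Proof.
split=> -[pi0 h]; split=> //; [move=> s sb|move=> y [fy yb]].
  rewrite -fsbig_count; under eq_fsbigr do rewrite -mulr_natr.
  apply: h; split; last by rewrite fsbig_count.
  apply: (sub_finite_set _ (finite_seq s)) => x /=.
  by rewrite -lt0n -has_count has_pred1.
have [s sE] := fsbig_multiset fy.
under eq_fsbigr do rewrite mulr_natr.
by rewrite sE; apply: h; rewrite -(sE _ id).
Qed.

(** Otherwise [pi] could be lowered at [x + y] to [pi x + pi y]: validity survives because every
    occurrence of [x + y] in a list can be replaced by the two entries [x] and [y]. *)
Lemma minimal_subadditive pi x y : minimal b pi -> pi (x + y) <= pi x + pi y.
Proof.
move=> [/valid_seqP[pi0 piv] mini]; rewrite leNgt; apply/negP => lt.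
pose pi' z := if z == x + y then pi x + pi y else pi z.
suff : pi' = pi by move=> /(congr1 (@^~ (x + y))); rewrite /pi' eqxx; lra.
apply: mini => [|z]; last by rewrite /pi'; case: eqP => [->|//]; exact: ltW.
apply/valid_seqP; split=> [z|s sb].
  by rewrite /pi'; case: ifP => // _; rewrite addr_ge0.
pose r z := if z == x + y then [:: x; y] else [:: z].
have rE (V : nmodType) (F : G -> V) : \sum_(z <- flatten [seq r z | z <- s]) F z =
    \sum_(z <- s) if z == x + y then F x + F y else F z.
  rewrite big_flatten big_map; apply: eq_bigr => z _.
  by rewrite /r; case: ifP => _; rewrite ?big_cons big_nil /= addr0.
rewrite -rE; apply: piv; rewrite rE -{}sb; apply: eq_bigr => z _.
by case: eqP.
Qed.

(** Truncation at 1 preserves validity: a list with a truncated entry already has sum at least 1. *)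
Lemma minimal_le1 pi x : minimal b pi -> pi x <= 1.
Proof.
move=> [/valid_seqP[pi0 piv] mini].
suff /(congr1 (@^~ x)) /= <- : (fun z => Num.min (pi z) 1) = pi by rewrite ge_min lexx orbT.
apply: mini => [|z]; last by rewrite ge_min lexx.
have m0 z : 0 <= Num.min (pi z) 1 by rewrite le_min pi0 ler01.
apply/valid_seqP; split=> // s sb.
have [/hasP[z zs z1]|/hasPn h] := boolP (has (fun z => 1 < pi z) s).
  rewrite (big_rem z zs) /= (min_idPr (ltW z1)) lerDl.
  exact: sumr_ge0.
rewrite (eq_big_seq pi); first exact: piv.
by move=> z /h; rewrite -leNgt => /min_idPl.
Qed.

Lemma valid_ge1 pi : valid b pi -> 1 <= pi b.
Proof. by move=> /valid_seqP[_ /(_ [:: b])]; rewrite !big_seq1; apply. Qed.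

(** The sufficiency half of the Gomory-Johnson criterion. Validity of a smaller [pi'] on the list
    [x, b - x] leaves no room below the symmetry relation. *)
Lemma minimal_of_symmetric pi : (forall x, 0 <= pi x) -> pi 0 = 0 ->
  (forall x y, pi (x + y) <= pi x + pi y) -> (forall x, pi x + pi (b - x) = 1) ->
  minimal b pi.
Proof.
move=> pi0 piO subadd sym; split.
  apply/valid_seqP; split => // s sb.
  have <- : pi b = 1 by rewrite -(sym b) subrr piO addr0.
  rewrite -sb; elim: s {sb} => [|x s IH]; first by rewrite !big_nil piO.
  by rewrite !big_cons; apply: le_trans (subadd _ _) _; rewrite lerD2l.
move=> pi' /valid_seqP[_ v'] le'; apply/funext => x.
apply/eqP; rewrite eq_le le' /=.
have := v' [:: x; b - x]; rewrite !big_cons !big_nil !addr0 addrC subrK => /(_ erefl).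
have := sym x; have := le' (b - x); lra.
Qed.

End gomory_johnson.

(** * Superadditive sequences and step approximations of the logarithm *)

Section superadditive.
Context {R : realType}.

(* Summing [f i + f (m + 1 - i) <= f (m + 1)] over i gives
   [2 S_m <= m f_(m+1)], so that [S_m / (m (m + 1))] is nondecreasing. *)
Lemma superadditive_harmonic_sum (f : nat -> R) (M : nat) :
  (forall i j, (i + j <= M.+1)%N -> f i + f j <= f (i + j)%N) -> f M.+1 <= 1 ->
  \sum_(j < M) f j.+1 / j.+1%:R <= 1.
Proof.
move=> fD fM1; pose S m := \sum_(j < m) f j.+1.
have SS m : S m.+1 = S m + f m.+1 by rewrite /S big_ord_recr.
have S2 m : (m <= M)%N -> 2 * S m <= m%:R * f m.+1.
  move=> mM; rewrite mulr_natl mulr2n /S.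
  rewrite [X in _ + X](reindex_inj rev_ord_inj) /= -big_split /= -[m in leRHS]card_ord.
  rewrite mulr_natl -sumr_const; apply: ler_sum => i _.
  have im : (i.+1 + (m - i.+1).+1 = m.+1)%N by rewrite subnSK// addSn subnKC// ltnW.
  by apply: le_trans (fD _ _ _) _; rewrite im ?card_ord.
(* That is, [S m / (m (m + 1)) <= 1 / (2 (M + 1))], by descending induction from [m = M], where
   [f M.+1 <= 1] enters. *)
have SM m : (m <= M)%N -> 2 * M.+1%:R * S m <= m%:R * m.+1%:R.
  move=> mM; rewrite -(subKn mM); elim: (M - m)%N => [|k IH].
    rewrite subn0; have := S2 M (leqnn M); have : M%:R * f M.+1 <= M%:R :> R by rewrite ler_piMr.
    have : 0 <= M.+1%:R :> R by []. nra.
  have [kM|kM] := ltnP k M; last first.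
    by have /eqP -> : (M - k.+1 == 0)%N; [rewrite subn_eq0 leqW|rewrite /S big_ord0 mulr0 mul0r].
  move: IH; rewrite -(subnSK kM); set p := (M - k.+1)%N => IH.
  have pM : (p <= M)%N by rewrite leq_subr.
  have h1 : (p%:R + 2) * S p <= p%:R * S p.+1.
    by rewrite SS; have := S2 p pM; lra.
  have h2 : 2 * M.+1%:R * ((p%:R + 2) * S p) <= p%:R * p.+1%:R * (p%:R + 2).
    apply: (@le_trans _ _ (2 * M.+1%:R * (p%:R * S p.+1))); first by rewrite ler_wpM2l.
    rewrite mulrCA -mulrA; apply: ler_wpM2l => //.
    by move: IH; rewrite -[p.+2%:R]natr1 -[p.+1%:R]natr1; lra.
  by rewrite -(ler_pM2r (_ : 0 < p%:R + 2)) ?ltr_wpDl//; lra.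
(* Summation by parts. The bounds on [S] then give [M / (2 (M + 1))] for the boundary term and as
   much for the sum, in total [M / (M + 1)]. *)
have T m : \sum_(j < m) f j.+1 / j.+1%:R =
    S m / m.+1%:R + \sum_(j < m) S j.+1 / (j.+1%:R * j.+2%:R).
  elim: m => [|m IH]; first by rewrite !big_ord0 /S big_ord0 mul0r addr0.
  rewrite !big_ord_recr/= IH SS.
  have h1 : m.+1%:R != 0 :> R by []. have h2 : m.+2%:R != 0 :> R by [].
  have : m.+2%:R = m.+1%:R + 1 :> R by rewrite natr1.
  move: (\sum_(_ < _) _) => Q; move: h1 h2; move: (m.+1%:R) (m.+2%:R) => u v u0 v0 uv.
  have u1 : u + 1 != 0 by rewrite -uv.
  by rewrite uv; field; rewrite u0 u1.
have M0 : 0 < M.+1%:R :> R by [].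
have hS m : (m <= M)%N -> S m <= m%:R * m.+1%:R / (2 * M.+1%:R).
  by move=> mM; rewrite ler_pdivlMr ?mulr_gt0//; have := SM m mM; lra.
rewrite T; apply: (@le_trans _ _ (M%:R / (2 * M.+1%:R) + \sum_(j < M) (2 * M.+1%:R)^-1)).
  apply: lerD.
    rewrite ler_pdivrMr//; apply: le_trans (hS M _) _ => //.
    by rewrite mulrAC.
  apply: ler_sum => j _; rewrite ler_pdivrMr ?mulr_gt0//.
  by apply: le_trans (hS j.+1 _) _ => //; rewrite mulrC.
rewrite sumr_const card_ord -[X in _ + X]mulr_natr.
have -> : M%:R = M.+1%:R - 1 :> R by rewrite -natr1 addrK.
rewrite -(ler_pM2r M0) mulrDl.
move: M0; move: (M.+1%:R) => u u0.
have -> : (u - 1) / (2 * u) * u + (2 * u)^-1 * (u - 1) * u = u - 1 by field; lra.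
lra.
Qed.

Lemma ln_step_le (n : nat) : ln (n.+2%:R / n.+1%:R : R) <= n.+1%:R^-1.
Proof.
rewrite -[n.+2%:R]natr1 mulrDl divff// mul1r; apply: le_ln1Dx.
by rewrite (@lt_trans _ _ 0)// ?invr_gt0// oppr_lt0.
Qed.

Lemma ln_step_ge (n : nat) : n.+2%:R^-1 <= ln (n.+2%:R / n.+1%:R : R).
Proof.
rewrite -[leRHS]opprK -lnV ?posrE// ?divr_gt0// invf_div lerNr.
have -> : n.+1%:R / n.+2%:R = 1 + (- n.+2%:R^-1) :> R.
  by rewrite -[n.+2%:R]natr1 -[X in X / _](addrK 1) mulrBl divff// ?natr1// mul1r.
apply: le_ln1Dx; rewrite ltrN2 invf_lt1// ltr1n//.
Qed.

(** Increments of [ln] over the grid cells from [j / N] to [(j + 1) / N] telescope, and the selected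
    cells cover [[q, 1]]. In the application [p] is a value of [pi] and [q] that value cut off from
    below, which lets the sum start at [L]. *)
Lemma ln_upper_step (L N : nat) (p q : R) : (0 < L <= N)%N -> p <= q -> L%:R / N%:R <= q ->
  - ln q <= \sum_(L <= j < N | p <= j.+1%:R / N%:R) ln (j.+1%:R / j%:R).
Proof.
move=> /andP[L0 LN] pq Lq.
have N0n : (0 < N)%N by exact: leq_trans LN.
have N0 : 0 < N%:R :> R by rewrite ltr0n.
have q0 : 0 < q by apply: lt_le_trans Lq; rewrite divr_gt0// ltr0n.
have c0 j : (0 < j)%N -> 0 <= ln (j.+1%:R / j%:R : R).
  by case: j => // j _; apply: le_trans (ln_step_ge j); rewrite invr_ge0.
have h n : (L <= n)%N -> ln (n%:R / N%:R) - ln q <=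
    \sum_(L <= j < n | p <= j.+1%:R / N%:R) ln (j.+1%:R / j%:R).
  elim: n => [|n IH]; first by rewrite leqNgt L0.
  rewrite leq_eqVlt => /predU1P[<-|]; last rewrite ltnS => Ln.
    by rewrite big_geq// subr_le0 ler_ln// posrE divr_gt0// ltr0n.
  have n0 : (0 < n)%N by exact: leq_trans Ln.
  rewrite big_mkcond big_nat_recr//= -big_mkcond/=; case: ifPn => [_|].
    apply: le_trans (lerD (IH Ln) (lexx _)).
    rewrite !ln_div ?posrE ?ltr0n//.
    by move: (ln n.+1%:R) (ln N%:R) (ln q) (ln n%:R) => u v w z; lra.
  rewrite -ltNge addr0 => pn; apply: (@le_trans _ _ 0).
    rewrite subr_le0 ler_ln ?posrE ?divr_gt0//; exact: ltW (lt_le_trans pn pq).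
  by rewrite big_nat_cond; apply: sumr_ge0 => j /andP[/andP[Lj _] _]; rewrite c0// (leq_trans L0).
by have := h N LN; rewrite divff ?gt_eqF// ln1 sub0r.
Qed.

(** Dual to [ln_upper_step]: here the selected cells lie inside [[p, 1]]. *)
Lemma ln_lower_step (N : nat) (p : R) : 0 < p <= 1 -> (0 < N)%N ->
  \sum_(1 <= j < N | p <= j%:R / N%:R) ln (j.+1%:R / j%:R) <= - ln p.
Proof.
move=> /andP[p0 p1] N0; have N0' : 0 < N%:R :> R by rewrite ltr0n.
have h n : (0 < n)%N -> \sum_(1 <= j < n | p <= j%:R / N%:R) ln (j.+1%:R / j%:R) <=
    Num.max 0 (ln (n%:R / N%:R) - ln p).
  elim: n => [//|n IH _].
  have [->|n0] := posnP n; first by rewrite big_geq// le_max lexx.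
  rewrite big_mkcond big_nat_recr//= -big_mkcond/=.
  have nS : ln (n%:R / N%:R : R) <= ln (n.+1%:R / N%:R).
    by rewrite ler_ln ?posrE ?divr_gt0 ?ltr0n// ler_pM2r ?invr_gt0// ler_nat.
  case: ifPn => [pn|_]; last first.
    rewrite addr0; apply: le_trans (IH n0) _; rewrite ge_max !le_max lexx /=.
    by rewrite lerD2r nS orbT.
  have pl : ln p <= ln (n%:R / N%:R) by rewrite ler_ln// posrE divr_gt0// ltr0n.
  apply: le_trans (lerD (IH n0) (lexx _)) _.
  rewrite !max_r ?subr_ge0 ?(le_trans pl)//.
  rewrite !ln_div ?posrE ?ltr0n//.
  by move: (ln n.+1%:R) (ln N%:R) (ln p) (ln n%:R) => u v w z; lra.
have := h N N0; rewrite divff ?gt_eqF// ln1 sub0r (max_idPr _)// oppr_ge0.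
by apply: ln_le0.
Qed.

End superadditive.

(** * Integrals of logarithms *)

Section sublevel.
Context {R : realType} {d : measure_display} {T : measurableType d}.
Variable m : {measure set T -> \bar R}.
Hypothesis m1 : m setT = 1%E.
Implicit Types A B : set T.

Definition mass A : R := fine (m A).

Lemma massE A : measurable A -> m A = (mass A)%:E.
Proof.
move=> mA; rewrite fineK// ge0_fin_numE//; apply: (@le_lt_trans _ _ 1%E); last by rewrite ltry.
by rewrite -m1; apply: le_measure => //; exact/mem_set.
Qed.

Lemma le_mass A B : measurable A -> measurable B -> A `<=` B -> mass A <= mass B.
Proof. by move=> mA mB AB; rewrite -lee_fin -!massE//; apply: le_measure => //; exact/mem_set. Qed.

Lemma mass_ge0 A : 0 <= mass A.
Proof. exact: fine_ge0. Qed.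

Lemma mass_le1 A : measurable A -> mass A <= 1.
Proof.
move=> mA; have -> : 1 = mass setT by rewrite /mass m1.
exact: le_mass.
Qed.

Lemma mass_setC A : measurable A -> mass (~` A) = 1 - mass A.
Proof.
move=> mA; have mAC := measurableC mA.
have : m (A `|` ~` A) = (m A + m (~` A))%E.
  by apply: measureU => //; exact: setICr.
rewrite setUv m1 !massE// => /eqP.
by rewrite -EFinD eqe => /eqP ->; rewrite addrAC subrr add0r.
Qed.

Lemma integral_simple_sum (r : seq nat) (P : pred nat) (c : nat -> R) (E : nat -> set T) :
  (forall j, j \in r -> P j -> 0 <= c j) -> (forall j, measurable (E j)) ->
  (\int[m]_x (\sum_(j <- r | P j) c j * \1_(E j) x)%:E)%E =
  (\sum_(j <- r | P j) c j * mass (E j))%:E.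
Proof.
move=> c0 mE.
(* Extension by zero, so that the summands are nonnegative at every index and not only at the
   selected ones. *)
pose c' j := if (j \in r) && P j then c j else 0.
have c'0 j : 0 <= c' j by rewrite /c'; case: ifP => // /andP[? ?]; exact: c0.
have cE (F : nat -> R) : \sum_(j <- r | P j) c j * F j = \sum_(j <- r) c' j * F j.
  rewrite big_mkcond [LHS]big_seq [RHS]big_seq; apply: eq_bigr => j jr.
  by rewrite /c' jr /=; case: ifP; rewrite ?mul0r.
rewrite cE; under eq_integral do rewrite cE -sumEFin.
have mc j : measurable_fun [set: T] (fun x => (c' j * \1_(E j) x)%:E).
  by apply/measurable_EFinP; apply: measurable_funM; [exact: measurable_cst|exact: measurable_indic].
have c'1 j (x : T) : [set: T] x -> (0 <= (c' j * \1_(E j) x)%:E)%E by rewrite lee_fin mulr_ge0.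
rewrite (ge0_integral_sum _ measurableT mc c'1) -sumEFin; apply: eq_bigr => j _.
under eq_integral do rewrite EFinM.
have mi : measurable_fun [set: T] (fun x => (\1_(E j) x : R)%:E).
  exact/measurable_EFinP/measurable_indic.
have i0 (x : T) : [set: T] x -> (0 <= (\1_(E j) x : R)%:E)%E by rewrite lee_fin.
rewrite (ge0_integralZl_EFin _ measurableT i0 mi (c'0 j)).
by rewrite integral_indic// setIT EFinM -massE.
Qed.

Lemma measurable_sublevel (pi : T -> R) t : measurable_fun [set: T] pi ->
  measurable ([set x | pi x <= t]).
Proof.
move=> mpi; rewrite (_ : [set x | _] = setT `&` pi @^-1` `]-oo, t]%classic).
  exact: (mpi measurableT _ (measurable_itv _)).
by apply/seteqP; split => x /=; rewrite in_itv /=; [|case].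
Qed.

Lemma measurable_lne (pi : T -> R) : measurable_fun [set: T] pi ->
  measurable_fun [set: T] (fun x => - lne (pi x)%:E)%E.
Proof.
move=> mpi; apply: measurableT_comp => //; rewrite /lne; apply: measurable_fun_ifT.
- by apply: measurable_fun_ler => //; exact: measurable_cst.
- exact: measurable_cst.
- by apply/measurable_EFinP; apply: measurableT_comp.
Qed.

Section bounds.
Variable pi : T -> R.
Hypotheses (pi0 : forall x, 0 <= pi x) (pi1 : forall x, pi x <= 1).
Hypothesis mpi : measurable_fun [set: T] pi.

Let F t := mass [set x | pi x <= t].

Section upper_bound.
Hypothesis F_superadditive :
  forall s t, 0 <= s -> 0 <= t -> s + t < 1 -> F s + F t <= F (s + t).

(** Cutting [pi] off below at [1 / (K + 1)] bounds the logarithm; the cutoffs increase to [- ln pi],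
    including where [pi] vanishes. *)
Let g (K : nat) x : \bar R := (- ln (Num.max (pi x) K.+1%:R^-1))%:E.

Let g_ge0 K x : (0 <= g K x)%E.
Proof. by rewrite lee_fin oppr_ge0; apply: ln_le0; rewrite ge_max pi1 invf_le1// ler1n. Qed.

Let g_measurable K : measurable_fun [set: T] (g K).
Proof.
apply/measurable_EFinP; apply: measurableT_comp => //; apply: measurableT_comp => //.
by apply: measurable_maxr => //; exact: measurable_cst.
Qed.

Let g_homo x i n : (i <= n)%N -> (g i x <= g n x)%E.
Proof.
move=> mn; rewrite lee_fin lerN2 ler_ln ?posrE ?lt_max ?invr_gt0 ?ltr0n ?orbT//.
by rewrite ge_max !le_max lexx /= lef_pV2 ?posrE ?ltr0n// ler_nat ltnS mn orbT.
Qed.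

Lemma integral_truncated_ln (K : nat) : (\int[m]_x g K x <= 1)%E.
Proof.
suff h (L : nat) : (\int[m]_x g K x <= (1 + 5 / L.+1%:R)%:E)%E.
  apply/lee_addgt0Pr => e e0; have := h (Num.truncn (5 / e)).
  move=> /le_trans; apply; rewrite -EFinD lee_fin lerD2l ler_pdivrMr// mulrC -ler_pdivrMr//.
  by apply: ltW; exact: truncnS_gt.
(* With this [N] the cutoff [1 / (K + 1)] is the grid point [l / N], and [l] controls the mesh. *)
pose l := L.+2; pose N := (K.+1 * l)%N.
have lN : (l <= N)%N by rewrite leq_pmull.
have [M NM] : exists M, N = M.+2.
  by move: lN; rewrite /l; case: (N) => [|[|M]] // _; exists M.
have N0 : 0 < N%:R :> R by rewrite ltr0n (leq_trans _ lN).
have mE t : measurable ([set x | pi x <= t]) by exact: measurable_sublevel.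
pose c j : R := ln (j.+1%:R / j%:R).
have c0 j : (0 < j)%N -> 0 <= c j <= j%:R^-1.
  case: j => // j _; rewrite /c ln_step_le andbT.
  by apply: le_trans (ln_step_ge j); rewrite invr_ge0.
have g_le x : (g K x <= (\sum_(l <= j < N) c j * \1_[set x | pi x <= j.+1%:R / N%:R] x)%:E)%E.
  rewrite lee_fin; apply: (le_trans (ln_upper_step (L := l) (N := N) (p := pi x) _ _ _)).
  - by rewrite lN.
  - by rewrite le_max lexx.
  - have l_neq0 : l%:R != 0 :> R by rewrite pnatr_eq0.
    by rewrite /N natrM invfM mulrCA (divff l_neq0) mulr1 le_max lexx orbT.
  - rewrite big_mkcond; apply: ler_sum => j _.
    rewrite indicE; case: ifPn => h; first by rewrite mem_set//= mulr1.
    by rewrite memNset/= ?mulr0n ?mulr0//; exact/negP.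
pose f i := F (i%:R / N%:R).
apply: (@le_trans _ _ (\sum_(l <= j < N) c j * f j.+1)%:E).
  rewrite /f /F -integral_simple_sum//; last first.
    by move=> j; rewrite mem_index_iota => /andP[lj _] _; have /andP[] := c0 j (leq_trans (ltn0Sn _) lj).
  apply: ge0_le_integral => //.
  apply/measurable_EFinP; apply: measurable_sum => j.
  by apply: measurable_funM => //; exact: measurable_indic.
have f01 i : 0 <= f i <= 1 by rewrite mass_ge0 mass_le1.
(* Superadditivity holds only for [s + t < 1], so the harmonic bound stops at the grid point
   [(N - 1) / N]; this is why [N = M.+2]. *)
have harm : \sum_(j < M) f j.+1 / j.+1%:R <= 1.
  apply: superadditive_harmonic_sum; last by have /andP[] := f01 M.+1.
  move=> i j ijM; rewrite /f natrD mulrDl.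
  apply: F_superadditive; rewrite ?divr_ge0//.
  by rewrite -mulrDl -natrD ltr_pdivrMr// mul1r ltr_nat NM.
have l0 : 0 < l%:R :> R by [].
rewrite lee_fin; apply: (@le_trans _ _ ((1 + l%:R^-1) * \sum_(0 <= j < N) f j.+1 / j.+1%:R)).
  rewrite mulr_sumr [leRHS](big_cat_nat (leq0n l) lN)/=.
  apply: ler_wpDl.
    by apply: sumr_ge0 => j _; rewrite mulr_ge0 ?divr_ge0//; have /andP[] := f01 j.+1.
  rewrite big_nat [leRHS]big_nat; apply: ler_sum => j /andP[lj _].
  have j0 : (0 < j)%N by exact: leq_trans lj.
  have /andP[cj0 cj] := c0 j j0; have /andP[fj0 _] := f01 j.+1.
  rewrite mulrCA [leRHS]mulrC ler_wpM2r//; apply: le_trans cj _.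
  have j0' : 0 < j%:R :> R by rewrite ltr0n.
  (* Passing from [1 / j], which bounds the increment of [ln], to [1 / (j + 1)] costs a factor at
     most [1 + 1 / l]. *)
  have -> : j%:R^-1 = (1 + j%:R^-1) / j.+1%:R :> R.
    rewrite -[j.+1%:R]natr1; have : j%:R + 1 != 0 :> R by rewrite natr1.
    by move: (j%:R) (lt0r_neq0 j0') => u u0 u1; field; rewrite u1 u0.
  by rewrite ler_wpM2r// lerD2l lef_pV2 ?posrE// ler_nat.
rewrite NM big_mkord !big_ord_recr/= -/(f _).
have u_ge (k : nat) : (L.+1 <= k)%N -> f k / k%:R <= L.+1%:R^-1.
  move=> Lk; have /andP[f0 f1] := f01 k.
  have k0 : 0 < k%:R :> R by rewrite ltr0n (leq_trans _ Lk).
  apply: (@le_trans _ _ (k%:R^-1)); first by rewrite ler_piMl// invr_ge0 ltW.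
  by rewrite lef_pV2 ?posrE// ler_nat.
have LM : (L.+1 <= M.+1)%N by rewrite -ltnS -NM (leq_trans _ lN).
have h1 := u_ge _ LM; have h2 := u_ge _ (leqW LM).
have lL : l%:R^-1 <= L.+1%:R^-1 :> R by rewrite lef_pV2 ?posrE// ler_nat.
have l0' : 0 <= l%:R^-1 :> R by rewrite invr_ge0.
have L1 : L.+1%:R^-1 <= 1 :> R by rewrite invf_le1// ler1n.
move: h1 h2 lL L1 l0' harm; move: (L.+1%:R^-1) (l%:R^-1) => u v.
move: (\sum_(_ < _) _) (f M.+1 / _) (f M.+2 / _) => s p q hp hq vu u1 v0 s1.
(* The two last terms are left over from the harmonic sum, each at most [u]. The 5 comes from
   [(1 + v) (1 + 2 u) <= 1 + 5 u] for [v <= u <= 1]. *)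
apply: (@le_trans _ _ ((1 + v) * (1 + u + u))).
  by apply: ler_wpM2l; lra.
nra.
Qed.

Lemma integral_ln_le1 : (\int[m]_x (- lne (pi x)%:E) <= 1)%E.
Proof.
have limg x : g ^~ x @ \oo --> (- lne (pi x)%:E)%E.
  have [p0|p0] := eqVneq (pi x) 0.
    rewrite p0 le0_lneNy//= /g p0; apply/cvgeyPge => A.
    near=> K; rewrite lee_fin max_r ?invr_ge0// lnV ?posrE// opprK.
    rewrite -ler_expR lnK ?posrE//; apply: le_trans (_ : K%:R <= _); last by rewrite ler_nat.
    by near: K; exact: nbhs_infty_ger.
  have pp : 0 < pi x by rewrite lt_neqAle eq_sym p0 pi0.
  rewrite lne_EFin// -EFinN; apply: cvg_near_cst.
  near=> K; rewrite /g max_l// -[leRHS]invrK lef_pV2 ?posrE ?invr_gt0//.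
  apply: le_trans (_ : K%:R <= _); last by rewrite ler_nat.
  by near: K; exact: nbhs_infty_ger.
under eq_integral do rewrite -(cvg_lim _ (limg _))//.
rewrite monotone_convergence//.
- apply: lime_le; last by apply: nearW => K; exact: integral_truncated_ln.
  apply: ereal_nondecreasing_is_cvgn => i n mn; apply: ge0_le_integral => //.
  by move=> x _; exact: g_homo.
- by move=> x _ i n; exact: g_homo.
Unshelve. all: by end_near. Qed.

End upper_bound.

Lemma integral_ln_ge1 : (forall N j : nat, (0 < j < N)%N -> j%:R / N%:R <= F (j%:R / N%:R)) ->
  (1 <= \int[m]_x (- lne (pi x)%:E))%E.
Proof.
move=> Fge; suff h (L : nat) : ((1 - 2 / L.+1%:R)%:E <= \int[m]_x (- lne (pi x)%:E))%E.
  apply/lee_subgt0Pr => e e0; have := h (Num.truncn (2 / e)).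
  apply: le_trans; rewrite -EFinB lee_fin lerD2l lerN2 ler_pdivrMr// mulrC -ler_pdivrMr//.
  by apply: ltW; exact: truncnS_gt.
(* Each cell [j >= l] contributes at least [j / (j + 1) / N >= (1 - 1 / l) / N], and there are
   [N - l] of them: the total is [(1 - 1 / l)^2 >= 1 - 2 / l]. *)
pose l := L.+1; pose N := (l * l)%N.
have l0 : 0 < l%:R :> R by [].
have lN : (l <= N)%N by rewrite leq_pmull.
have N0n : (0 < N)%N by exact: leq_trans lN.
have N0 : 0 < N%:R :> R by rewrite ltr0n.
have mE t : measurable [set x | pi x <= t] by exact: measurable_sublevel.
pose c j : R := ln (j.+1%:R / j%:R).
have c_ge j : (0 < j)%N -> j.+1%:R^-1 <= c j.
  by case: j => // j _; exact: ln_step_ge.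
have c0 j : (0 < j)%N -> 0 <= c j.
  by move=> /c_ge; apply: le_trans; rewrite invr_ge0.
apply: (@le_trans _ _ (\int[m]_x
    (\sum_(1 <= j < N) c j * \1_[set x | pi x <= j%:R / N%:R] x)%:E)%E); last first.
  apply: ge0_le_integral => //.
  - move=> x _; rewrite lee_fin big_nat; apply: sumr_ge0 => j /andP[j0 _].
    by rewrite mulr_ge0// c0.
  - apply/measurable_EFinP; apply: measurable_sum => j.
    by apply: measurable_funM => //; exact: measurable_indic.
  - exact: measurable_lne.
  move=> x _; have [p0|p0] := eqVneq (pi x) 0; first by rewrite p0 le0_lneNy//= leey.
  have pp : 0 < pi x by rewrite lt_neqAle eq_sym p0 pi0.
  rewrite lne_EFin// -EFinN lee_fin.
  apply: le_trans (ln_lower_step (p := pi x) _ N0n); last by rewrite pp pi1.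
  rewrite [leRHS]big_mkcond; apply: ler_sum => j _.
  rewrite indicE; case: ifPn => h; first by rewrite mem_set//= mulr1.
  by rewrite memNset/= ?mulr0n ?mulr0//; exact/negP.
rewrite integral_simple_sum//; last by move=> j; rewrite mem_index_iota => /andP[/c0].
rewrite lee_fin; apply: (@le_trans _ _ (\sum_(l <= j < N) (1 - l%:R^-1) / N%:R)).
  rewrite big_const_nat iter_addr_0 -[leRHS]mulr_natr natrB// /N natrM.
  have : l%:R^-1 <= 1 :> R by rewrite invf_le1// ler1n.
  have : 0 < l%:R^-1 :> R by rewrite invr_gt0.
  have -> : (1 - l%:R^-1) / (l%:R * l%:R) * (l%:R * l%:R - l%:R) =
            (1 - l%:R^-1) * (1 - l%:R^-1) :> R by move: (l%:R) (lt0r_neq0 l0) => u u0; field.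
  rewrite -/l; move: (l%:R^-1) => u u0 u1; nra.
rewrite [leRHS](big_cat_nat (ltn0Sn L) lN)/= ler_wpDl//.
  by rewrite big_nat; apply: sumr_ge0 => j /andP[j0 _]; rewrite mulr_ge0 ?mass_ge0// c0.
rewrite big_nat [leRHS]big_nat; apply: ler_sum => j /andP[lj jN].
have j0 : (0 < j)%N by exact: leq_trans lj.
have j0' : 0 < j%:R :> R by rewrite ltr0n.
apply: (@le_trans _ _ (j.+1%:R^-1 * (j%:R / N%:R))); last first.
  by apply: ler_pM; [rewrite invr_ge0|rewrite divr_ge0|exact: c_ge|apply: Fge; rewrite j0].
rewrite mulrA ler_wpM2r ?invr_ge0//.
have -> : j.+1%:R^-1 * j%:R = 1 - j.+1%:R^-1 :> R.
  rewrite -[j.+1%:R]natr1; have : j%:R + 1 != 0 :> R by rewrite natr1.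
  by move: (j%:R) => u u1; field.
by rewrite lerD2l lerN2 lef_pV2 ?posrE// ler_nat (leq_trans lj).
Qed.

End bounds.
End sublevel.

(** * Sublevel sets of a minimal function *)

Section completion.
Context {R : realType} {G : topologicalZmodType} (mu : probability (borel G) R).
Implicit Types (x y : G) (A B : set G).

Local Notation cG := (caratheodory_type (mu^*)%mu).
Local Notation cmu := (haar_completion mu).
Local Notation vol := (vol mu).

Lemma borel_caratheodory A : measurable (A : set (borel G)) -> measurable (A : set cG).
Proof. exact: caratheodory_measurable_mu_ext. Qed.

Lemma haar_completionE A : measurable (A : set (borel G)) -> cmu A = mu A.
Proof. exact: measurable_mu_extE. Qed.

Lemma haar_completion_setT : cmu setT = 1%E.
Proof. by rewrite haar_completionE// probability_setT. Qed.

Local Notation cvol := (mass cmu).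

Lemma cvol_borel A : measurable (A : set (borel G)) -> cvol A = vol A.
Proof. by move=> mA; rewrite /mass haar_completionE. Qed.

Hypotheses (cptG : compact [set: G]) (hausG : hausdorff_space G) (haar : is_haar mu).

(** The completed measure of the complement of [A] is an infimum over countable Borel covers. The
    complement of a near-optimal cover is a Borel subset of [A], to which [vol_inner] applies. *)
Lemma cvol_inner A (e : R) : measurable (A : set cG) -> 0 < e ->
  exists K, [/\ compact K, K `<=` A & cvol A - e < vol K].
Proof.
move=> mA e0; have e20 : 0 < e / 2 by rewrite divr_gt0.
have mC := measurableC mA.
have : (cmu (~` A) < (cvol (~` A) + e / 2)%:E)%E by rewrite (massE haar_completion_setT)// lte_fin ltrDl.
move=> /ereal_inf_lt[_ [B [mB AB] <-]] Bl.
have mU : measurable (\bigcup_n B n : set (borel G)) by exact: bigcupT_measurable.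
have vU : vol (\bigcup_n B n) < cvol (~` A) + e / 2.
  rewrite -lte_fin -volE//; apply: le_lt_trans Bl.
  exact: measure_sigma_subadditive.
have [K [cK KU Kl]] := vol_inner cptG haar (measurableC mU) e20.
exists K; split => //.
  by apply: subset_trans KU _; rewrite -[X in _ `<=` X](setCK A); exact: subsetC.
by move: Kl vU; rewrite vol_setC// (mass_setC haar_completion_setT)//; lra.
Qed.

Hypothesis connG : connected [set: G].

Section upper_bound.
Variables (b : G) (pi : G -> R).
Hypotheses (pi0 : forall x, 0 <= pi x) (pi1 : forall x, pi x <= 1).
Hypothesis pi_subadd : forall x y, pi (x + y) <= pi x + pi y.
Hypotheses (pib : 1 <= pi b) (mpi : measurable_fun [set: cG] pi).

Local Notation F t := (cvol [set x | pi x <= t]).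

(** Kneser's inequality is applied to compact sets [K], [L] inside the two sublevel sets. If their
    measures add up to more than 1, then [K + L] is everything and contains [b], giving
    [1 <= pi b <= s + t], contrary to [s + t < 1]. *)
Lemma cvol_sublevel_superadditive s t : 0 <= s -> 0 <= t -> s + t < 1 -> F s + F t <= F (s + t).
Proof.
move=> s0 t0 st1; apply/ler_addgt0Pr => e e0; have e20 : 0 < e / 2 by rewrite divr_gt0.
have mF u : measurable ([set x | pi x <= u] : set cG) by exact: measurable_sublevel.
have [K [cK Ks Kl]] := cvol_inner (mF s) e20.
have [L [cL Lt Ll]] := cvol_inner (mF t) e20.
have vF (C : set G) u : compact C -> C `<=` [set x | pi x <= u] -> vol C <= F u.
  move=> cC Cu; have mC := borel_compact hausG cC; rewrite -cvol_borel//.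
  by apply: (le_mass haar_completion_setT) => //; exact: borel_caratheodory.
suff : vol K + vol L <= F (s + t) by lra.
have [K0|/set0P K0] := eqVneq K set0.
  rewrite K0 vol_set0 add0r; apply: vF => // x /Lt /= h.
  by apply: le_trans h _; rewrite lerDr.
have [L0|/set0P L0] := eqVneq L set0.
  rewrite L0 vol_set0 addr0; apply: vF => // x /Ks /= h.
  by apply: le_trans h _; rewrite lerDl.
have KLst : sumset K L `<=` [set x | pi x <= s + t].
  move=> _ [x /Ks /= xs [y /Lt /= yt <-]].
  by apply: le_trans (pi_subadd _ _) _; exact: lerD.
have cKL := compact_sumset cK cL.
have [h|h] := leP (vol K + vol L) 1.
  by apply: le_trans (vF _ _ cKL KLst); exact: kneser.
have : pi b <= s + t by apply: KLst; rewrite (sumset_setT cptG hausG haar).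
by move=> pb; have := le_lt_trans (le_trans pib pb) st1; rewrite ltxx.
Qed.

End upper_bound.
End completion.

(** * Homomorphisms onto the circle and GMI functions *)

Section angle_map.
Context {R : realType} {G : topologicalZmodType} (mu : probability (borel G) R).
Implicit Types (x y : G).

Local Notation cG := (caratheodory_type (mu^*)%mu).
Local Notation cmu := (haar_completion mu).
Local Notation vol := (vol mu).

(* A surjective Borel homomorphism onto the circle [0, 1[. *)
Record angle_map (th : G -> R) : Prop := AngleMap {
  angle_range : forall x, 0 <= th x < 1 ;
  angle_add : forall x y, exists k : int, th (x + y) = th x + th y - k%:~R ;
  angle_surj : forall t, 0 <= t < 1 -> exists x, th x = t ;
  angle_borel : measurable_fun [set: borel G] th }.

Definition gmi (beta t : R) : R :=
  if t <= beta then t / beta else (1 - t) / (1 - beta).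

(** In this form subadditivity only asks to bound one of the two affine pieces at a time. *)
Lemma gmi_min beta t : 0 < beta < 1 -> gmi beta t = Num.min (t / beta) ((1 - t) / (1 - beta)).
Proof.
move=> /andP[b0 b1]; have b1' : 0 < 1 - beta by rewrite subr_gt0.
rewrite /gmi; case: ifPn => [tb|]; last rewrite -ltNge => tb.
  by rewrite min_l// (@le_trans _ _ 1)// ?ler_pdivrMr// ?ler_pdivlMr//; lra.
by rewrite min_r// (@le_trans _ _ 1)// ?ler_pdivrMr// ?ler_pdivlMr//; lra.
Qed.

Hypothesis haar : is_haar mu.
Variables (th : G -> R) (b : G).
Hypotheses (thA : angle_map th) (thb : th b != 0).

Let th_ge0 x : 0 <= th x. Proof. by have /andP[] := angle_range thA x. Qed.
Let th_lt1 x : th x < 1. Proof. by have /andP[] := angle_range thA x. Qed.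

Lemma angleD x y : th (x + y) = if th x + th y < 1 then th x + th y else th x + th y - 1.
Proof.
have [k thk] := angle_add thA x y.
have x0 := th_ge0 x; have x1 := th_lt1 x; have y0 := th_ge0 y; have y1 := th_lt1 y.
have xy0 := th_ge0 (x + y); have xy1 := th_lt1 (x + y).
have k0 : -1 < k by rewrite -(ltr_int R); lra.
have k2 : k < 2 by rewrite -(ltr_int R); lra.
have [k_eq|k_eq] : k = 0 \/ k = 1.
  by move: k0 k2; case: (k) => [[|[|n]]|n] // _ _; [left|right].
  by rewrite thk k_eq subr0 ifT//; move: xy1; rewrite thk k_eq subr0.
by rewrite thk k_eq ifF//; apply/negbTE; rewrite -leNgt; move: xy0; rewrite thk k_eq; lra.
Qed.

Lemma angle0 : th 0 = 0.
Proof.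
have := angleD 0 0; rewrite addr0; have := th_lt1 0; have := th_ge0 0.
by case: ifP => _; lra.
Qed.

Lemma angleB x y : th (x - y) = if th y <= th x then th x - th y else th x - th y + 1.
Proof.
have := th_lt1 (x - y); have := th_ge0 (x - y); have := th_lt1 y; have := th_ge0 y.
have := angleD (x - y) y; rewrite subrK.
by case: ifPn => h1 E; case: ifPn => h2; move: h1 h2; rewrite -?leNgt -?ltNge; lra.
Qed.

Let beta := th b.
Let b0 : 0 < beta. Proof. by rewrite lt_neqAle eq_sym thb th_ge0. Qed.
Let b1 : beta < 1. Proof. exact: th_lt1. Qed.

Lemma gmi_minimal : minimal b (fun x => gmi beta (th x)).
Proof.
have bb : 0 < beta < 1 by rewrite b0.
have c0 : 0 < beta^-1 by rewrite invr_gt0.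
have d0 : 0 < (1 - beta)^-1 by rewrite invr_gt0 subr_gt0.
apply: minimal_of_symmetric => [x||x y|x].
- have := th_lt1 x; have := th_ge0 x => x0 x1.
  by rewrite /gmi; case: ifP => _; apply: mulr_ge0; lra.
- by rewrite /gmi angle0 (ltW b0) mul0r.
- rewrite !gmi_min// angleD; move: (th_lt1 x) (th_ge0 x) (th_lt1 y) (th_ge0 y).
  move: c0 d0; move: (th x) (th y) (beta^-1) ((1 - beta)^-1) => s t c d c0 d0 s1 s0 t1 t0.
  (* With the signs of these products recorded, every case of the subadditivity inequality is linear
     in the products. *)
  have sc : 0 <= s * c by apply: mulr_ge0; lra.
  have tc : 0 <= t * c by apply: mulr_ge0; lra.
  have sd : 0 <= s * d by apply: mulr_ge0; lra.
  have td : 0 <= t * d by apply: mulr_ge0; lra.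
  have sc' : 0 <= (1 - s) * c by apply: mulr_ge0; lra.
  have tc' : 0 <= (1 - t) * c by apply: mulr_ge0; lra.
  have sd' : 0 <= (1 - s) * d by apply: mulr_ge0; lra.
  have td' : 0 <= (1 - t) * d by apply: mulr_ge0; lra.
  rewrite ge_min; case: ltP => st; case: (leP (s * c)) => _; case: (leP (t * c)) => _;
    by apply/orP; first [left; lra|right; lra].
- have bi : beta / beta = 1 by rewrite divff// gt_eqF.
  have bi' : (1 - beta) / (1 - beta) = 1 by rewrite divff// gt_eqF// subr_gt0.
  rewrite /gmi angleB -/beta; move: (th_lt1 x) (th_ge0 x).
  move: (th x) b0 b1 bi bi' {bb c0 d0}; move: (beta^-1) ((1 - beta)^-1) beta => c d p.
  move=> s p0 p1 pc pd s1 s0.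
  case: ifPn => h1; case: ifPn => h2; move: h1 h2; rewrite -?leNgt -?ltNge => h1 h2; lra.
Qed.

Lemma gmi_borel : measurable_fun [set: borel G] (fun x => gmi beta (th x)).
Proof.
have mth := angle_borel thA.
apply: measurable_fun_ifT.
- by apply: measurable_fun_ler => //; exact: measurable_cst.
- by apply: measurable_funM => //; exact: measurable_cst.
- by apply: measurable_funM => //; apply: measurable_funB => //; exact: measurable_cst.
Qed.

Let sublevel_borel t : measurable ([set x | gmi beta (th x) <= t] : set (borel G)).
Proof. exact: measurable_sublevel gmi_borel. Qed.

Lemma gmi_minimal_measurable : minimal_measurable mu b (fun x => gmi beta (th x)).
Proof.
split; first exact: gmi_minimal.
by move=> _ Y mY; rewrite setTI; apply: borel_caratheodory; rewrite -[X in measurable X]setTI; exact: gmi_borel.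
Qed.

Let arc t := [set x | th x < t].

Let arc_borel t : measurable (arc t : set (borel G)).
Proof.
rewrite -[arc t]setTI [arc t](_ : _ = th @^-1` `]-oo, t[%classic); last first.
  by apply/seteqP; split => x /=; rewrite in_itv.
have mth := angle_borel thA; apply: (mth measurableT); exact: measurable_itv.
Qed.

(** The arc [[s, s + t[] is the translate of [[0, t[] by a point of angle [s]. *)
Let arcD s t : 0 <= s -> 0 <= t -> s + t <= 1 -> vol (arc (s + t)) = vol (arc s) + vol (arc t).
Proof.
move=> s0 t0 st1.
have [s1|s1] := ltP s 1; last first.
  have -> : t = 0 by lra.
  rewrite addr0 [X in _ + vol X](_ : _ = set0) ?vol_set0 ?addr0//.
  by apply/seteqP; split=> // x; rewrite /arc /= ltNge th_ge0.
have [x xs] : exists x, th x = s by apply: angle_surj thA _ _; rewrite s0.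
rewrite (vol_setDI mu (arc_borel (s + t)) (arc_borel s)) addrC; congr (_ + _).
  by congr vol; apply/seteqP; split => [y []//|y]; rewrite /arc /= => ys; split => //; lra.
rewrite -(vol_translate haar x (arc_borel t)); congr vol; apply/seteqP; split.
- move=> y [yst /negP]; rewrite -leNgt => ys; exists (y - x); last by rewrite subrK.
  by rewrite /arc /= angleB xs ys; move: yst; rewrite /arc /=; lra.
- move=> _ [y yt <-]; move: yt; rewrite /arc /= => yt; rewrite angleD xs.
  have := th_ge0 y => y0; rewrite ifT; last by lra.
  by split; [lra|apply/negP; rewrite -leNgt; lra].
Qed.

(** [N] arcs of length [1 / N] have equal measure and total 1. Rational lengths suffice for
    [integral_ln_ge1]. *)
Lemma vol_angle (N j : nat) : (0 < N)%N -> (j <= N)%N -> vol [set x | th x < j%:R / N%:R] = j%:R / N%:R.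
Proof.
move=> N0 jN; have N0' : 0 < N%:R :> R by rewrite ltr0n.
have h i : (i <= N)%N -> vol (arc (i%:R / N%:R)) = i%:R * vol (arc (N%:R^-1)).
  elim: i => [|i IH] iN.
    rewrite !mul0r (_ : arc 0 = set0) ?vol_set0//.
    by apply/seteqP; split=> // x; rewrite /arc /= ltNge th_ge0.
  rewrite -natr1 mulrDl mul1r arcD ?divr_ge0 ?invr_ge0//.
    by rewrite IH ?(ltnW iN)// mulrDl mul1r.
  by rewrite -[X in _ + X]mul1r -mulrDl natr1 ler_pdivrMr// mul1r ler_nat.
have := h N (leqnn N); rewrite divff ?gt_eqF// (_ : arc 1 = setT) ?vol_setT; last first.
  by apply/seteqP; split=> // x _; exact: th_lt1.
move=> v1; rewrite -/(arc _) h//; congr (_ * _).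
by apply: (mulfI (lt0r_neq0 N0')); rewrite -v1 divff// gt_eqF.
Qed.

(** The sublevel set at [t] is the arc of length [t] running from [1 - t * (1 - beta)] through 0 to
    [t * beta]; it contains a translate of [arc t]. *)
Lemma vol_gmi_ge (N j : nat) : (0 < j < N)%N -> j%:R / N%:R <= vol [set x | gmi beta (th x) <= j%:R / N%:R].
Proof.
move=> /andP[j0 jN]; have N0 : (0 < N)%N by exact: leq_trans jN.
rewrite -{1}(vol_angle N0 (ltnW jN)).
have : 0 < j%:R / N%:R :> R by rewrite divr_gt0// ltr0n.
have : j%:R / N%:R < 1 :> R by rewrite ltr_pdivrMr ?ltr0n// mul1r ltr_nat.
move: (j%:R / N%:R) => t t1 t0; rewrite -/(arc t).
have b0' := b0; have b1' := b1.
have u0 : 0 < t * (1 - beta) by rewrite mulr_gt0// subr_gt0.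
have u1 : t * (1 - beta) < t by rewrite gtr_pMr//; lra.
have [x xt] : exists x, th x = 1 - t * (1 - beta) by apply: angle_surj thA _ _; lra.
rewrite -(vol_translate haar x (arc_borel t)); apply: le_vol.
- exact: borel_translate.
- exact: sublevel_borel.
move=> _ [y yt <-]; move: yt; rewrite /arc /= => yt; have := th_ge0 y => y0.
have tb : t * beta < beta by rewrite gtr_pMl.
have tb' : t * (1 - beta) < 1 - beta by rewrite gtr_pMl// subr_gt0.
rewrite angleD xt.
case: ifPn => h1; rewrite /gmi; case: ifPn => h2; move: h1 h2; rewrite -?leNgt -?ltNge => h1 h2;
  rewrite ler_pdivrMr ?subr_gt0//; lra.
Qed.

Lemma integral_ln_gmi_ge1 : (1 <= \int[cmu]_x (- lne (gmi beta (th x))%:E))%E.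
Proof.
have [mini mgmi] := gmi_minimal_measurable.
apply: (integral_ln_ge1 (haar_completion_setT mu) _ _ mgmi) => [x|x|N j jN].
- by have [[]] := mini.
- exact: (minimal_le1 _ mini).
- rewrite cvol_borel; first exact: vol_gmi_ge.
  exact: sublevel_borel.
Qed.

End angle_map.

(** * Continuous solutions of d'Alembert's equation *)

(** A cluster point exists by compactness of the segment, and for an ultrafilter it is a limit. *)
Lemma ultra_bounded_cvg {R : realType} (F : set_system nat) (v : nat -> R) (C : R) :
  UltraFilter F -> (forall n, `|v n| <= C) -> exists2 l, `|l| <= C & v @ F --> l.
Proof.
move=> FU vC; have [] := @segment_compact R (- C) C (v @ F).
  by apply: nearW => n; rewrite /= in_itv /= -ler_norml.
move=> l [lC cl]; exists l; first by rewrite ler_norml; move: lC; rewrite /= in_itv.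
move=> B nB; have [//|FB] := in_ultra_setVsetC (v @^-1` B) FU.
by have [z [nBz Bz]] := cl (~` B) B FB nB.
Qed.

Section dalembert.
Context {R : realType} {G : topologicalZmodType} (mu : probability (borel G) R).
Hypotheses (cptG : compact [set: G]) (hausG : hausdorff_space G) (haar : is_haar mu).
Implicit Types (x y a : G) (f g h k phi psi : G -> R).

Local Notation haar_int := (haar_int mu).

Lemma near_sub (P : G -> Prop) x :
  (\forall w \near (0 : G), P w) -> \forall x' \near x, P (x' - x).
Proof.
have c0 : (fun x' => x' - x) @ x --> (0 : G).
  by rewrite -(subrr x); exact: translation_continuous.
by move=> nP; exact: c0 _ nP.
Qed.

Lemma continuousM f g : continuous f -> continuous g -> continuous (fun x => f x * g x).
Proof. by move=> cf cg x; apply: cvgM; [exact: cf|exact: cg]. Qed.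

Lemma continuousD f g : continuous f -> continuous g -> continuous (fun x => f x + g x).
Proof. by move=> cf cg x; apply: cvgD; [exact: cf|exact: cg]. Qed.

Lemma continuousB f g : continuous f -> continuous g -> continuous (fun x => f x - g x).
Proof. by move=> cf cg x; apply: cvgB; [exact: cf|exact: cg]. Qed.

Lemma continuous_translater f a : continuous f -> continuous (fun x => f (a + x)).
Proof.
move=> cf; have -> : (fun x => f (a + x)) = (fun x => f (x + a)).
  by apply/funext => x; rewrite addrC.
exact: continuous_translate.
Qed.

Lemma continuousN f : continuous f -> continuous (fun x => - f x).
Proof. by move=> cf x; apply: cvgN; exact: cf. Qed.

Lemma continuous_cst (r : R) : continuous (fun _ : G => r).
Proof. by move=> x; exact: cvg_cst. Qed.

Lemma haar_int_bound f (C : R) : continuous f -> (forall x, `|f x| <= C) -> `|haar_int f| <= C.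
Proof.
move=> cf fC; rewrite ler_norml -[X in X <= _ <= _](haar_int_cst mu) -[X in _ <= _ <= X](haar_int_cst mu).
by apply/andP; split; apply: le_haar_int => //; try (by move=> x; exact: cvg_cst);
  move=> x; have := fC x; rewrite ler_norml => /andP[].
Qed.

Definition conv k phi x := haar_int (fun y => k y * phi (y + x)).

Definition mean a f x := (f (x + a) + f (x - a)) / 2.

Lemma mean_continuous a f : continuous f -> continuous (mean a f).
Proof.
move=> cf x; apply: cvgM; last exact: cvg_cst.
by apply: cvgD; exact: continuous_translate.
Qed.


(** Invariance moves the shift from [phi] onto [k], so the modulus of continuity involves only [k]
    and a bound on [phi]. This is the source of equicontinuity. *)
Lemma conv_modulus k phi (C e : R) v x : continuous k -> continuous phi ->
  (forall y, `|phi y| <= C) -> (forall y, `|k (y - v) - k y| <= e) ->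
  `|conv k phi (x + v) - conv k phi x| <= e * C.
Proof.
move=> ck cp pC ke.
have ckp : continuous (fun y => k y * phi (y + x)).
  by apply: continuousM => //; exact: continuous_translate.
have ckv : continuous (fun y => k (y - v) * phi (y + x)).
  by apply: continuousM; exact: continuous_translate.
have -> : conv k phi (x + v) = haar_int (fun y => k (y - v) * phi (y + x)).
  rewrite -[RHS](haar_int_translate cptG haar v)//.
  by congr haar_int; apply/funext => y; rewrite addrK addrAC addrA.
rewrite -haar_intB//; apply: haar_int_bound => [|y]; first exact: continuousB.
by rewrite -mulrBl normrM; apply: ler_pM; rewrite ?normr_ge0 ?ke ?pC.
Qed.

Lemma conv_continuous k phi : continuous k -> continuous phi -> continuous (conv k phi).
Proof.
move=> ck cp x; have [C C0 pC] := continuous_bounded cptG cp.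
apply/cvgrPdist_le => e e0.
have eC : 0 < e / C by rewrite divr_gt0.
have nk : \forall v \near (0 : G), forall y, `|k (y + v) - k y| < e / C.
  exact: near_uniform_continuous.
have c0 : (fun x' => x - x') @ x --> (0 : G).
  by rewrite -(subrr x); exact: reflection_continuous.
have h : \forall x' \near x, forall y, `|k (y + (x - x')) - k y| < e / C by exact: c0 _ nk.
apply: filterS h => x' kx'.
have := @conv_modulus k phi C (e / C) (x' - x) x ck cp pC.
rewrite [x + _]addrC subrK distrC divfK ?gt_eqF//; apply => y.
by rewrite opprB; exact: ltW.
Qed.

Ltac cont := repeat match goal with
  | H : continuous ?f |- continuous ?f => exact H
  | H : continuous ?f |- continuous (fun x => ?f x) => exact H
  | |- continuous (fun x => @?f x * @?g x) => apply: (@continuousM f g)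
  | |- continuous (fun x => @?f x + @?g x) => apply: (@continuousD f g)
  | |- continuous (fun x => ?f (x + ?a)) => apply: (@continuous_translate G _ f a)
  | |- continuous (fun x => ?f (?a + x)) => apply: (@continuous_translater f a)
  | |- continuous (fun x => - @?f x) => apply: (@continuousN f)
  | |- continuous (mean _ _) => apply: mean_continuous
  | |- continuous (conv _ _) => apply: conv_continuous
  | |- continuous (fun x => mean ?a ?f x) => apply: (@mean_continuous a f)
  | |- continuous (fun x => conv ?a ?f x) => apply: (@conv_continuous a f)
  | |- continuous (fun _ => ?r) => apply: (@continuous_cst r)
  end.

Lemma conv_mean k phi a x : continuous k -> continuous phi ->
  conv k (mean a phi) x = mean a (conv k phi) x.
Proof.
move=> ck cp; rewrite /mean /conv -haar_intD//; try by cont.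
rewrite mulrC -haar_intZ; try by cont.
congr haar_int; apply/funext => y; rewrite !addrA; ring.
Qed.

Lemma convD k phi psi x : continuous k -> continuous phi -> continuous psi ->
  conv k (fun z => phi z + psi z) x = conv k phi x + conv k psi x.
Proof.
move=> ck cp cq; rewrite /conv -haar_intD//; try by cont.
by congr haar_int; apply/funext => y; ring.
Qed.

Lemma convZ k phi r x : continuous k -> continuous phi ->
  conv k (fun z => r * phi z) x = r * conv k phi x.
Proof.
move=> ck cp; rewrite /conv -haar_intZ//; try by cont.
by congr haar_int; apply/funext => y; ring.
Qed.

Lemma conv_defect k phi a c x : continuous k -> continuous phi ->
  conv k (fun x => mean a phi x - c * phi x) x = mean a (conv k phi) x - c * conv k phi x.
Proof.
move=> ck cp; rewrite -conv_mean// -mulNr -convZ// -convD//; try by cont.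
by congr conv; apply/funext => y; rewrite mulNr.
Qed.

Definition corr g := conv g g.

Lemma corrZ g r x : continuous g -> corr (fun z => r * g z) x = r ^+ 2 * corr g x.
Proof.
move=> cg; rewrite /corr /conv -haar_intZ//; try by cont.
by congr haar_int; apply/funext => y; ring.
Qed.

Lemma corr_ge0 g : 0 <= corr g 0.
Proof. by apply: haar_int_ge0 => y; rewrite addr0 -expr2 sqr_ge0. Qed.

(** Integrate [2 |p q| <= p^2 + q^2]; both squares have the same integral by invariance. *)
Lemma corr_le g x : continuous g -> `|corr g x| <= corr g 0.
Proof.
move=> cg.
have c1 : continuous (fun y => g y * g y) by cont.
have c2 : continuous (fun y => g (y + x) * g (y + x)).
  by apply: continuousM; exact: continuous_translate.
have E : corr g 0 = haar_int (fun y => (1 / 2) * (g y * g y + g (y + x) * g (y + x))).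
  rewrite haar_intZ//; last by cont.
  rewrite haar_intD// (haar_int_translate cptG haar x c1).
  have -> : corr g 0 = haar_int (fun y => g y * g y).
    by congr haar_int; apply/funext => y; rewrite addr0.
  lra.
have c3 : continuous (fun y => g y * g (y + x)) by cont.
rewrite ler_norml E; apply/andP; split.
  rewrite lerNl -[leLHS]mulN1r -haar_intZ//.
  apply: le_haar_int => //; [by cont|by cont|move=> y].
  have := sqr_ge0 (g y + g (y + x)); nra.
apply: le_haar_int => //; [by cont|move=> y].
have := sqr_ge0 (g y - g (y + x)); nra.
Qed.

(* Positive-definite functions are stable under [phi +- mean a phi]. *)
Lemma corr_mean g a (e : R) x : continuous g -> e ^+ 2 = 1 ->
  corr (fun y => g y + e * g (y + a)) x = 2 * (corr g x + e * mean a (corr g) x).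
Proof.
move=> cg e1; rewrite /mean /corr /conv.
have -> : haar_int (fun y => g y * g (y + (x - a))) = haar_int (fun y => g (y + a) * g (y + x)).
  rewrite -(haar_int_translate cptG haar a); last by cont.
  by congr haar_int; apply/funext => y; congr (_ * g _); rewrite addrA addrAC addrK.
have -> : haar_int (fun y => g y * g (y + x)) =
    (1 / 2) * (haar_int (fun y => g y * g (y + x)) + haar_int (fun y => g (y + a) * g (y + x + a))).
  have cc : continuous (fun y => g y * g (y + x)) by cont.
  have -> : haar_int (fun y => g (y + a) * g (y + x + a)) = haar_int (fun y => g y * g (y + x)).
    rewrite -[RHS](haar_int_translate cptG haar a cc).
    by congr haar_int; apply/funext => y; rewrite [y + x + a]addrAC.
  lra.
set A := (X in haar_int X + _); set B := (X in _ + haar_int X).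
set C := (fun y => g y * g (y + (x + a))); set D := (fun y => g (y + a) * g (y + x)).
have cA : continuous A by rewrite /A; cont.
have cB : continuous B.
  rewrite /B; apply: continuousM; first by cont.
  have -> : (fun y => g (y + x + a)) = (fun y => g (y + (x + a))) by apply/funext => y; rewrite addrA.
  by cont.
have cC : continuous C by rewrite /C; cont.
have cD : continuous D by rewrite /D; cont.
transitivity (haar_int (fun y => (A y + B y) + e * (C y + D y))).
  congr haar_int; apply/funext => y; rewrite /A /B /C /D addrA.
  ring: e1.
rewrite haar_intD//; [|by cont|by cont].
rewrite haar_intD// haar_intZ; [|by cont|by cont].
rewrite haar_intD//; lra.
Qed.

(** * Maximizing the energy over normalized autocorrelations *)

Section maximizer.
Variable k : G -> R.
Hypothesis ck : continuous k.

(** The squared L2 norm of the image of [psi] under [conv k], a compact operator; this is what makes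
    limits of maximizing sequences available. *)
Definition energy psi := haar_int (fun x => conv k psi x * conv k psi x).

Lemma energyZ psi r : continuous psi -> energy (fun x => r * psi x) = r ^+ 2 * energy psi.
Proof.
move=> cp; rewrite /energy -haar_intZ//; last by cont.
by congr haar_int; apply/funext => x; rewrite convZ//; ring.
Qed.

Lemma energy_ge0 psi : 0 <= energy psi.
Proof. by apply: haar_int_ge0 => x; rewrite -expr2 sqr_ge0. Qed.

Let K := sval (cid2 (continuous_bounded cptG ck)).
Let K0 : 0 < K. Proof. by rewrite /K; case: cid2. Qed.
Let kK x : `|k x| <= K. Proof. by rewrite /K; case: cid2. Qed.

Lemma conv_bound psi (C : R) x : continuous psi -> (forall y, `|psi y| <= C) ->
  `|conv k psi x| <= K * C.
Proof.
move=> cp pC; apply: haar_int_bound => [|y]; first by cont.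
by rewrite normrM; apply: ler_pM.
Qed.

Lemma energy_bound psi (C : R) : continuous psi -> (forall y, `|psi y| <= C) ->
  energy psi <= (K * C) ^+ 2.
Proof.
move=> cp pC; apply: le_trans (ler_norm _) _; apply: haar_int_bound => [|x]; first by cont.
by rewrite normrM -expr2; have := conv_bound x cp pC; rewrite lerXn2r ?nnegrE ?(le_trans _ (conv_bound x cp pC)).
Qed.

Let E := [set energy (corr g) | g in [set g | continuous g /\ corr g 0 = 1]].
Let M := sup E.

Lemma corr_continuous g : continuous g -> continuous (corr g).
Proof. by move=> cg; rewrite /corr; cont. Qed.

Let E_ub : has_ubound E.
Proof.
exists ((K * 1) ^+ 2) => _ [g [cg g1] <-]; apply: energy_bound => [|y].
  exact: corr_continuous.
by rewrite -g1; exact: corr_le.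
Qed.

Lemma energy_corr_le g : continuous g -> energy (corr g) <= M * corr g 0 ^+ 2.
Proof.
move=> cg; have [g0|g0] := eqVneq (corr g 0) 0.
  have -> : energy (corr g) = 0.
    rewrite /energy -[RHS](haar_int_cst mu); congr haar_int; apply/funext => x.
    (* Zero is written as a product to fit the shape of [convZ]. *)
    suff -> : corr g = fun=> 0 * 0 by rewrite convZ ?mul0r//; cont.
    apply/funext => y; rewrite mul0r; apply/eqP; rewrite -normr_eq0 eq_le normr_ge0 andbT.
    by rewrite -g0; exact: corr_le.
  by rewrite g0 expr0n mulr0.
have g1 : 0 < corr g 0 by rewrite lt_neqAle eq_sym g0 corr_ge0.
pose r := (Num.sqrt (corr g 0))^-1.
have r2 : r ^+ 2 = (corr g 0)^-1 by rewrite exprVn sqr_sqrtr// ltW.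
have : energy (corr (fun x => r * g x)) <= M.
  apply: (sup_ubound E_ub); exists (fun x => r * g x) => //; split; first by cont.
  by rewrite corrZ// r2 mulVf.
have -> : corr (fun x => r * g x) = (fun x => r ^+ 2 * corr g x).
  by apply/funext => x; rewrite corrZ.
rewrite energyZ ?r2; last exact: corr_continuous.
by rewrite exprVn mulrC ler_pdivrMr ?exprn_gt0.
Qed.

(* Near-maximizers are near-eigenfunctions of every [mean a]: if [energy phi]
   is almost maximal then so is the energy of [phi +- mean a phi] relative to its
   value at 0, and the parallelogram identity does the rest. *)
Lemma energy_defect g a : continuous g -> corr g 0 = 1 ->
  energy (fun x => mean a (corr g) x - corr g a * corr g x) <= M - energy (corr g).
Proof.
move=> cg g1; have cp := corr_continuous cg.
set phi := corr g; set c := phi a.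
pose U := conv k phi; pose S := conv k (mean a phi).
have cU : continuous U by rewrite /U; cont.
have cS : continuous S by rewrite /S; cont.
have c1 : `|c| <= 1 by rewrite -g1; exact: corr_le.
have meanE : mean a phi 0 = c.
  rewrite /mean add0r sub0r; suff -> : phi (- a) = phi a by rewrite -/c; lra.
  rewrite /phi /corr /conv -(haar_int_translate cptG haar a); last by cont.
  by congr haar_int; apply/funext => y; rewrite addrK mulrC.
have side (e : R) : e ^+ 2 = 1 -> haar_int (fun x => (U x + e * S x) * (U x + e * S x)) <= M * (1 + e * c) ^+ 2.
  move=> e1; have cge : continuous (fun y => g y + e * g (y + a)) by cont.
  have := energy_corr_le cge; rewrite corr_mean// -/phi meanE [phi 0](_ : _ = 1)//.
  have -> : corr (fun y => g y + e * g (y + a)) = (fun x => 2 * (phi x + e * mean a phi x)).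
    by apply/funext => x; rewrite corr_mean.
  rewrite energyZ; last by cont.
  rewrite exprMn mulrCA ler_pM2l ?exprn_gt0//; apply: le_trans.
  rewrite /energy le_eqVlt; apply/orP; left; apply/eqP; congr haar_int; apply/funext => x.
  by rewrite convD ?convZ//; cont.
have := side 1; have := side (-1); rewrite sqrrN expr1n => /(_ erefl) sm /(_ erefl) sp.
pose P := fun x => (U x + 1 * S x) * (U x + 1 * S x).
pose N := fun x => (U x + (-1) * S x) * (U x + (-1) * S x).
(* The weights produce the cross term of [(S - c U)^2] from [(U + S)^2] and [(U - S)^2]. Applied to
   the bounds [M (1 + c)^2] and [M (1 - c)^2] they give [(1 - c^2) M]. *)
have -> : energy (fun x => mean a phi x - c * phi x) =
    (1 - c) / 2 * haar_int P + (1 + c) / 2 * haar_int N - (1 - c ^+ 2) * energy phi.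
  rewrite /energy -!haar_intZ; try by rewrite /P /N; cont.
  rewrite -haar_intD; try by rewrite /P /N; cont.
  rewrite -haar_intB; try by rewrite /P /N; cont.
  congr haar_int; apply/funext => x.
  rewrite conv_defect// -conv_mean// -/(S x) -/(U x).
  by rewrite /P /N; field.
have : energy phi <= M by apply: (sup_ubound E_ub); exists g.
move: sm sp; rewrite -/P -/N; move: (haar_int P) (haar_int N) (energy phi) => p n e np pp eM.
have /andP[cl cr] : -1 <= c <= 1 by rewrite -ler_norml.
apply: (@le_trans _ _ ((1 - c) / 2 * (M * (1 + 1 * c) ^+ 2) +
    (1 + c) / 2 * (M * (1 + -1 * c) ^+ 2) - (1 - c ^+ 2) * e)).
  by rewrite lerD2r; apply: lerD; apply: ler_wpM2l => //; lra.
have -> : (1 - c) / 2 * (M * (1 + 1 * c) ^+ 2) +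
    (1 + c) / 2 * (M * (1 + -1 * c) ^+ 2) - (1 - c ^+ 2) * e = (1 - c ^+ 2) * (M - e) by field.
rewrite -[leRHS]mul1r ler_wpM2r ?subr_ge0//; have := sqr_ge0 c; lra.
Qed.

(** Replacing [u], [c] by [v], [c'] moves the defect by at most [r * (2 + K)]; then
    [D^2 <= 2 (D' - D)^2 + 2 D'^2], and [r <= 1] absorbs one factor [r]. *)
Let square_defect_le a u v (c c' r : R) x : 0 < r -> r <= 1 ->
  `|u x| <= K -> `|c'| <= 1 ->
  `|v x - u x| <= r -> `|v (x + a) - u (x + a)| <= r -> `|v (x - a) - u (x - a)| <= r ->
  `|c - c'| <= r ->
  (mean a u x - c * u x) * (mean a u x - c * u x) <= 2 * r * (2 + K) ^+ 2 +
    2 * ((mean a v x - c' * v x) * (mean a v x - c' * v x)).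
Proof.
move=> r0 r1 uK c1 h0 h1 h2 hc.
set D := mean a u x - _; set D' := mean a v x - _.
have DD : `|D' - D| <= r * (2 + K).
  have -> : D' - D = (v (x + a) - u (x + a)) / 2 + (v (x - a) - u (x - a)) / 2 +
      ((c - c') * u x - c' * (v x - u x)) by rewrite /D /D' /mean; field.
  have -> : r * (2 + K) = r / 2 + r / 2 + (r * K + 1 * r) by field.
  apply: le_trans (ler_normD _ _) _; apply: lerD.
    by apply: le_trans (ler_normD _ _) _; apply: lerD; rewrite normrM [X in _ * X]ger0_norm// ler_wpM2r.
  apply: le_trans (ler_normB _ _) _; apply: lerD; rewrite normrM; exact: ler_pM.
have : (D' - D) ^+ 2 <= r * (2 + K) ^+ 2.
  rewrite -real_normK ?num_real//; apply: (@le_trans _ _ ((r * (2 + K)) ^+ 2)).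
    by rewrite lerXn2r ?nnegrE// mulr_ge0 ?ltW// addr_gt0.
  by rewrite exprMn ler_wpM2r ?sqr_ge0// expr2 ler_piMr// ltW.
rewrite -[2 * r * _]mulrA; have := sqr_ge0 (D - 2 * D').
move: (r * (2 + K) ^+ 2) => w; move: (D) (D') => y z; nra.
Qed.

Variable g0 : G -> R.
Hypotheses (cg0 : continuous g0) (energy_g0 : 0 < energy (corr g0)).

Let M_gt0 : 0 < M.
Proof.
have := lt_le_trans energy_g0 (energy_corr_le cg0).
apply: contraTT; rewrite -!leNgt => M0; exact: mulr_le0_ge0 M0 (sqr_ge0 _).
Qed.

Lemma mean_eigenfunction : exists u (c : G -> R), [/\ continuous u, exists x, u x != 0,
  forall a x, mean a u x = c a * u x, forall a, `|c a| <= 1 &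
  forall e, 0 < e -> exists2 g, continuous g & forall x, `|conv k (corr g) x - u x| <= e].
Proof.
have E0 : E !=set0.
  apply/set0P/negP => /eqP E0; have := M_gt0; by rewrite /M E0 sup0 ltxx.
have /choice[g gP] : forall n : nat, exists g, [/\ continuous g, corr g 0 = 1 &
    M - n.+1%:R^-1 < energy (corr g)].
  move=> n; have n0 : 0 < n.+1%:R^-1 :> R by rewrite invr_gt0.
  have [_ [g [cg g1] <-] gn] := sup_adherent n0 (conj E0 E_ub).
  by exists g.
(* Along [F] all the sequences [v n x] and [corr (g n) a] converge at once, for every [x] and [a] of
   a possibly uncountable group. *)
have [F [FU oF]] := ultraFilterLemma (eventually_filter).
have cg n : continuous (g n) by have [] := gP n.
have cp n : continuous (corr (g n)) by exact: corr_continuous.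
have p1 n y : `|corr (g n) y| <= 1 by have [_ <- _] := gP n; exact: corr_le.
pose v n := conv k (corr (g n)).
have cv n : continuous (v n) by rewrite /v; cont.
have vK n x : `|v n x| <= K by rewrite -[K]mulr1; exact: conv_bound.
have /choice[u uP] : forall x, exists l, `|l| <= K /\ v ^~ x @ F --> l.
  by move=> x; have [l ? ?] := ultra_bounded_cvg FU (vK ^~ x); exists l.
have /choice[c cP] : forall a, exists l, `|l| <= 1 /\ (fun n => corr (g n) a) @ F --> l.
  by move=> a; have [l ? ?] := ultra_bounded_cvg FU (p1 ^~ a); exists l.
have equi e : 0 < e -> \forall w \near (0 : G), forall n x, `|v n (x + w) - v n x| <= e.
  move=> e0; have h := near_uniform_continuous cptG ck e0.
  have hN : \forall w \near (0 : G), forall y, `|k (y - w) - k y| < e.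
    have := @reflection_continuous G 0 0; rewrite /continuous_at subr0 => rc.
    have {}h : \forall w \near (0 : G), forall y, `|k (y + (0 - w)) - k y| < e by exact: rc _ h.
    by apply: filterS h => w kw y; have := kw y; rewrite sub0r.
  apply: filterS hN => w kw n x; rewrite -[e]mulr1; apply: conv_modulus => // y.
  exact/ltW/kw.
have equi_u e : 0 < e -> \forall w \near (0 : G), forall x, `|u (x + w) - u x| <= e.
  move=> e0; apply: filterS (equi e e0) => w vw x.
  have lim : `|v n (x + w) - v n x| @[n --> F] --> `|u (x + w) - u x|.
    by apply: cvg_norm; apply: cvgB; [exact: (uP (x + w)).2|exact: (uP x).2].
  apply: (cvgr_to_le lim); apply: nearW => n; exact: vw.
have cu : continuous u.
  move=> x; apply/cvgrPdist_le => e e0.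
  have c0 : (fun x' => x' - x) @ x --> (0 : G).
    by rewrite -(subrr x); exact: translation_continuous.
  have h : \forall x' \near x, forall y, `|u (y + (x' - x)) - u y| <= e by exact: c0 _ (equi_u e e0).
  by apply: filterS h => x' /(_ x); rewrite [x + _]addrC subrK distrC.
(* Ascoli's argument: pointwise convergence, equicontinuity and compactness make the convergence
   uniform. *)
have unif e : 0 < e -> \forall n \near F, forall x, `|v n x - u x| <= e.
  move=> e0; have e3 : 0 < e / 3 by rewrite divr_gt0.
  have [/compact_near_coveringP] := conj cptG I.
  move=> /(_ nat F (fun n x => `|v n x - u x| <= e)) h _.
  suff : \near F, [set: G] `<=` (fun x => `|v F x - u x| <= e).
    by apply: filterS => n hn x; exact: hn.
  apply: h => x _.
  have h1 : \forall x' \near x, forall n y, `|v n (y + (x' - x)) - v n y| <= e / 3.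
    exact: (near_sub (P := fun w => forall n y, `|v n (y + w) - v n y| <= e / 3) x (equi _ e3)).
  have h2 : \forall x' \near x, forall y, `|u (y + (x' - x)) - u y| <= e / 3.
    exact: (near_sub (P := fun w => forall y, `|u (y + w) - u y| <= e / 3) x (equi_u _ e3)).
  have h3 : \forall n \near F, `|u x - v n x| <= e / 3.
    by move: (uP x).2 => /cvgrPdist_le; apply.
  exists ([set x' | (forall n y, `|v n (y + (x' - x)) - v n y| <= e / 3) /\
     (forall y, `|u (y + (x' - x)) - u y| <= e / 3)], [set n | `|u x - v n x| <= e / 3]).
    by split => //; exact: filterI.
  move=> [x' n] /= [[/(_ n x) a1 /(_ x) a2] a3].
  move: a1 a2; rewrite [x + _]addrC subrK => a1 a2.
  move: (v n x') (v n x) (u x) (u x') a1 a2 a3 => p q s t a1 a2 a3.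
  have -> : p - t = (p - q) - (s - q) - (t - s) by ring.
  apply: le_trans (ler_normB _ _) _; have := ler_normB (p - q) (s - q); lra.
exists u, c; split => //.
(* A zero limit would make the energies at most [M / 4], whereas they exceed [M / 2] far along [F];
   positivity of [M] is used here. *)
- apply: contrapT => /forallNP u0.
  have u00 x : u x = 0 by apply/eqP; have := u0 x; move/negP; rewrite negbK.
  pose e := Num.min 1 (M / 4).
  have e0 : 0 < e by rewrite lt_min ltr01 divr_gt0.
  have e1 : e <= 1 by rewrite ge_min lexx.
  have eM : e <= M / 4 by rewrite ge_min lexx orbT.
  have M2 : 0 < M / 2 by rewrite divr_gt0.
  have hM : \forall n \near F, n.+1%:R^-1 < M / 2.
    apply: oF; have /cvgrPdist_lt/(_ _ M2) := @cvg_harmonic R.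
    by apply: filterS => n; rewrite sub0r normrN ger0_norm /= ?invr_ge0//.
  have [n [nu nM]] := filter_ex (filterI (unif e e0) hM).
  have [_ _ gn] := gP n.
  have : energy (corr (g n)) <= e ^+ 2.
    apply: le_trans (ler_norm _) _; apply: haar_int_bound => [|x]; first by cont.
    by have := nu x; rewrite u00 subr0 normrM -expr2 => h; rewrite lerXn2r ?nnegrE// ltW.
  have nM' : n.+1%:R^-1 < M / 2 := nM.
  have : e ^+ 2 <= e by rewrite expr2 ler_piMr// ltW.
  move: nM' gn; move: (energy _) (n.+1%:R^-1) (e ^+ 2) => y w z; lra.
- move=> a; pose D x := mean a u x - c a * u x.
  have cD : continuous D by rewrite /D; cont.
  have DD0 x : 0 <= D x * D x by rewrite -expr2 sqr_ge0.
  suff D0 : haar_int (fun x => D x * D x) = 0.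
    move=> x; have /eqP := haar_int_eq0 cptG haar (continuousM cD cD) DD0 D0 x.
    by rewrite mulf_eq0 orbb /D subr_eq0 => /eqP.
  apply/eqP; rewrite eq_le haar_int_ge0 ?andbT//.
  apply/ler_addgt0Pr => e e0; rewrite add0r.
  (* The error is [2 r (2 + K)^2] from the approximation of [u] and [c], plus twice an energy defect
     below [r]. *)
  pose r := Num.min 1 (e / (2 * (2 + K) ^+ 2 + 2)).
  have d0 : 0 < 2 * (2 + K) ^+ 2 + 2 by rewrite ltr_wpDl// mulr_ge0// sqr_ge0.
  have r0 : 0 < r by rewrite lt_min ltr01 divr_gt0.
  have r1 : r <= 1 by rewrite ge_min lexx.
  have re : r * (2 * (2 + K) ^+ 2 + 2) <= e by rewrite -ler_pdivlMr// ge_min lexx orbT.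
  have hM : \forall n \near F, n.+1%:R^-1 < r.
    apply: oF; have /cvgrPdist_lt/(_ _ r0) := @cvg_harmonic R.
    by apply: filterS => n; rewrite sub0r normrN ger0_norm /= ?invr_ge0//.
  have hc : \forall n \near F, `|c a - corr (g n) a| <= r.
    by move: (cP a).2 => /cvgrPdist_le; apply.
  have [n [[nu nM] nc]] := filter_ex (filterI (filterI (unif r r0) hM) hc).
  have [_ gn1 gn] := gP n.
  have := energy_defect a (cg n) gn1.
  pose Dn x := mean a (v n) x - corr (g n) a * v n x.
  have cDn : continuous Dn by rewrite /Dn; cont.
  have -> : energy (fun x => mean a (corr (g n)) x - corr (g n) a * corr (g n) x) =
      haar_int (fun x => Dn x * Dn x).
    by congr haar_int; apply/funext => x; rewrite conv_defect.
  move=> En; apply: (@le_trans _ _ (haar_int (fun x => 2 * r * (2 + K) ^+ 2 + 2 * (Dn x * Dn x)))).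
    apply: le_haar_int => //; [by cont|by cont|move=> x].
    exact: square_defect_le r0 r1 (uP x).1 (p1 n a) (nu x) (nu (x + a)) (nu (x - a)) nc.
  rewrite haar_intD ?haar_int_cst ?haar_intZ//; try by cont.
  apply: le_trans re; have nM' : n.+1%:R^-1 < r := nM.
  move: En gn nM'; move: (energy _) (n.+1%:R^-1) (haar_int _) ((2 + K) ^+ 2) => y w z t; lra.
- by move=> a; have [] := cP a.
- by move=> e /unif h; have [n nu] := filter_ex h; exists (g n).
Qed.

End maximizer.

(** Translation by [a] has translation by [- a] as adjoint, and [mean a] averages the two. *)
Lemma haar_int_mean u w a : continuous u -> continuous w ->
  haar_int (fun x => mean a u x * w x) = haar_int (fun x => u x * mean a w x).
Proof.
move=> cu cw.
have E (s : G) : haar_int (fun x => u (x + s) * w x) = haar_int (fun x => u x * w (x - s)).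
  rewrite -(haar_int_translate cptG haar s (f := fun x => u x * w (x - s))); last by cont.
  by congr haar_int; apply/funext => x; rewrite addrK.
have half (f g : G -> R) : continuous f -> continuous g ->
    haar_int (fun x => 2^-1 * (f x + g x)) = 2^-1 * (haar_int f + haar_int g).
  by move=> cf cg; rewrite haar_intZ ?haar_intD//; cont.
have -> : (fun x => mean a u x * w x) = (fun x => 2^-1 * (u (x + a) * w x + u (x - a) * w x)).
  by apply/funext => x; rewrite /mean; field.
have -> : (fun x => u x * mean a w x) = (fun x => 2^-1 * (u x * w (x - a) + u x * w (x - - a))).
  by apply/funext => x; rewrite opprK /mean; field.
by rewrite !half; try cont; rewrite !E.
Qed.

(** Self-adjointness moves [mean a] from the kernel to the result: such a convolution is orthogonal
    to every function fixed by [mean a]. *)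
Lemma conv_sub_mean q phi a x : continuous q -> continuous phi ->
  conv (fun y => q y - mean a q y) phi x = conv q phi x - mean a (conv q phi) x.
Proof.
move=> cq cp; have cpx : continuous (fun y => phi (y + x)) by cont.
rewrite -conv_mean// /conv.
have -> : haar_int (fun y => q y * mean a phi (y + x)) = haar_int (fun y => mean a q y * phi (y + x)).
  rewrite (haar_int_mean _ cq cpx); congr haar_int; apply/funext => y.
  by rewrite /mean [y + x + a]addrAC [y + x - a]addrAC.
rewrite -haar_intB; try by cont.
by congr haar_int; apply/funext => y; rewrite mulrBl.
Qed.

(** With [k = q - mean b q], the eigenfunction [u] is a uniform limit of functions orthogonal to
    those fixed by [mean b]. If [c b] were 1, [u] itself would be fixed, hence orthogonal to itself
    and zero. *)
Theorem exists_dalembert (b : G) : b != 0 -> exists c : G -> R, [/\ continuous c, c 0 = 1,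
  forall x, `|c x| <= 1, forall x y, c (x + y) + c (x - y) = 2 * c x * c y & c b != 1].
Proof.
move=> b0.
have [f [cf _ f1 f0]] : exists f : G -> R, [/\ continuous f, forall x, 0 <= f x <= 1,
    forall x, [set 0] x -> f x = 1 & forall x, ~ (~` [set b]) x -> f x = 0].
  apply: continuous_between => //.
  - exact: compact_set1.
  - by apply: closed_openC; apply: compact_closed => //; exact: compact_set1.
  - by move=> _ -> /eqP; rewrite eq_sym (negPf b0).
have f00 : f 0 = 1 by exact: f1.
have fb : f b = 0 by apply: f0 => /=; rewrite notK.
(* Since [2 k] is the autocorrelation of [h], vanishing energy would force [k = 0] and then [h = 0],
   against [h 0 = f 0 - f b = 1]. *)
pose h y := f y + -1 * f (y + b).
have ch : continuous h by rewrite /h; cont.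
pose q := corr f; have cq : continuous q by exact: corr_continuous.
pose k y := q y - mean b q y; have ck : continuous k by rewrite /k; cont.
have hk x : corr h x = 2 * k x by rewrite corr_mean ?sqrrN ?expr1n// mulN1r.
have Eh : 0 < energy k (corr h).
  rewrite lt_neqAle energy_ge0 andbT eq_sym; apply/eqP => Eh0.
  have cch := corr_continuous ch.
  have cv : continuous (conv k (corr h)) by cont.
  have sq (g : G -> R) x : 0 <= g x * g x by rewrite -expr2 sqr_ge0.
  have /eqP := haar_int_eq0 cptG haar (continuousM cv cv) (sq _) Eh0 0.
  rewrite mulf_eq0 orbb => /eqP.
  have -> : conv k (corr h) 0 = haar_int (fun y => 2 * (k y * k y)).
    by congr haar_int; apply/funext => y; rewrite addr0 hk; ring.
  rewrite haar_intZ; try by cont.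
  move=> /eqP; rewrite mulf_eq0 pnatr_eq0 /= => /eqP k2.
  have /eqP := haar_int_eq0 cptG haar (continuousM ck ck) (sq _) k2 0.
  rewrite mulf_eq0 orbb => /eqP k0; have := hk 0; rewrite k0 mulr0.
  have -> : corr h 0 = haar_int (fun y => h y * h y).
    by congr haar_int; apply/funext => y; rewrite addr0.
  move=> h2; have /eqP := haar_int_eq0 cptG haar (continuousM ch ch) (sq _) h2 0.
  by rewrite mulf_eq0 orbb /h add0r f00 fb mulr0 addr0 oner_eq0.
have [u [c [cu [x0 ux0] uc c1 ulim]]] := mean_eigenfunction ck ch Eh.
have cE a : c a = mean a u x0 / u x0 by rewrite uc mulfK.
exists c; split => //.
- have -> : c = (fun a => (u (x0 + a) + u (x0 - a)) * (2^-1 / u x0)).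
    by apply/funext => a; rewrite cE /mean; field.
  apply: continuousM; last exact: continuous_cst.
  apply: continuousD; first by cont.
  by move=> a; apply: continuous_comp; [exact: reflection_continuous|exact: cu].
- by rewrite cE /mean subr0 addr0; field.
(* [mean x (mean y u)] is the average of [mean (x + y) u] and [mean (x - y) u]; evaluation at [x0]
   gives the equation. *)
- move=> x y; apply: (mulIf ux0).
  have E : mean x (mean y u) x0 = c y * c x * u x0.
    have -> : mean y u = (fun z => c y * u z) by apply/funext => z; rewrite uc.
    by rewrite -mulrA -uc /mean; field.
  have -> : 2 * c x * c y * u x0 = 2 * mean x (mean y u) x0 by rewrite E; ring.
  rewrite mulrDl -!uc /mean.
  have -> : x0 + (x + y) = x0 + x + y by rewrite addrA.
  have -> : x0 - (x + y) = x0 - x - y by rewrite opprD addrA.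
  have -> : x0 + (x - y) = x0 + x - y by rewrite addrA.
  have -> : x0 - (x - y) = x0 - x + y by rewrite opprD opprK addrA.
  by field.
apply/eqP => cb1.
have ub : mean b u = u by apply/funext => x; rewrite uc cb1 mul1r.
have [C C0 uC] := continuous_bounded cptG cu.
suff u2 : haar_int (fun x => u x * u x) = 0.
  have sq x : 0 <= u x * u x by rewrite -expr2 sqr_ge0.
  have /eqP := haar_int_eq0 cptG haar (continuousM cu cu) sq u2 x0.
  by rewrite mulf_eq0 orbb (negPf ux0).
apply/eqP; rewrite -normr_eq0 eq_le normr_ge0 andbT.
apply/ler_addgt0Pr => e e0; rewrite add0r.
have [g cg gu] := ulim (e / C) (divr_gt0 e0 C0).
have cp := corr_continuous cg; have cw : continuous (conv q (corr g)) by cont.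
have ckg : continuous (conv k (corr g)) by cont.
have uw0 : haar_int (fun x => u x * conv k (corr g) x) = 0.
  have -> : (fun x => u x * conv k (corr g) x) =
      (fun x => u x * conv q (corr g) x - u x * mean b (conv q (corr g)) x).
    by apply/funext => x; rewrite conv_sub_mean// mulrBr.
  rewrite haar_intB; try by cont.
  by rewrite -haar_int_mean// ub subrr.
rewrite -[haar_int _]subr0 -uw0 -haar_intB; try by cont.
apply: haar_int_bound => [|x]; first by cont.
rewrite -mulrBr normrM distrC mulrC -[leRHS](divfK (lt0r_neq0 C0)).
exact: ler_pM.
Qed.

End dalembert.

(** * From d'Alembert's equation to a homomorphism onto the circle *)

Section circle_angle.
Context {R : realType}.
Implicit Types (c s t : R).

Local Notation tau := ((pi : R) *+ 2).

Lemma tau_gt0 : 0 < tau. Proof. by rewrite mulrn_wgt0// pi_gt0. Qed.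

(* The angle in [0, 1[, in turns, of a point (c, s) of the unit circle. *)
Definition circle_angle c s : R := if 0 <= s then acos c / tau else 1 - acos c / tau.

Lemma circle_bound c s : c ^+ 2 + s ^+ 2 = 1 -> -1 <= c <= 1.
Proof.
move=> cs; rewrite -ler_norml -[leRHS]normr1 -ler_sqr ?nnegrE//.
by rewrite !real_normK ?num_real// expr1n -cs lerDl sqr_ge0.
Qed.

Lemma circle_acos c s : c ^+ 2 + s ^+ 2 = 1 -> 0 <= acos c / tau <= 1 / 2.
Proof.
move=> cs; have cb := circle_bound cs.
rewrite divr_ge0 ?acos_ge0 ?(ltW tau_gt0)//= ler_pdivrMr ?tau_gt0//.
have -> : 1 / 2 * tau = pi by rewrite mulr2n; field.
exact: acos_lepi.
Qed.

Lemma circle_angle_range c s : c ^+ 2 + s ^+ 2 = 1 -> 0 <= circle_angle c s < 1.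
Proof.
move=> cs; have /andP[a0 a1] := circle_acos cs; rewrite /circle_angle; case: ifPn => [_|].
  by rewrite a0 (le_lt_trans a1)// ltr_pdivrMr// mul1r ltr1n.
rewrite -ltNge => s0; rewrite subr_ge0 (le_trans a1)/=; last by lra.
rewrite gtrBl divr_gt0 ?tau_gt0// acos_gt0//; have /andP[c1 c2] := circle_bound cs.
rewrite c1 lt_neqAle c2 andbT; apply/eqP => c_eq; move: cs; rewrite c_eq expr1n.
have : 0 < s ^+ 2 by rewrite exprn_even_gt0//= lt_eqF.
lra.
Qed.

Lemma circle_angleK c s : c ^+ 2 + s ^+ 2 = 1 ->
  cos (circle_angle c s * tau) = c /\ sin (circle_angle c s * tau) = s.
Proof.
move=> cs; have cb := circle_bound cs.
have tau0 := lt0r_neq0 tau_gt0.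
have s2 : 1 - c ^+ 2 = s ^+ 2 by rewrite -cs addrAC subrr add0r.
rewrite /circle_angle; case: ifPn => [s0|].
  by rewrite divfK// acosK ?in_itv// sin_acos// s2 sqrtr_sqr ger0_norm.
rewrite -ltNge => s0; rewrite mulrBl mul1r divfK// addrC cosD2pi sinD2pi cosN sinN.
by rewrite acosK ?in_itv// sin_acos// s2 sqrtr_sqr ltr0_norm// opprK.
Qed.

(** The cosine of [(u - v) * tau] is 1 minus twice the squared sine of [(u - v) * pi], and that sine
    is positive for [0 < u - v < 1]. *)
Lemma angle_inj t t' : 0 <= t < 1 -> 0 <= t' < 1 -> cos (t * tau) = cos (t' * tau) ->
  sin (t * tau) = sin (t' * tau) -> t = t'.
Proof.
suff h u v : 0 <= u -> u < 1 -> 0 <= v -> v < u -> cos (u * tau) = cos (v * tau) ->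
    sin (u * tau) = sin (v * tau) -> False.
  move=> /andP[t0 t1] /andP[t0' t1'] ct st; have [|tt|//] := ltgtP t t'.
    by move=> tt; case: (h t' t).
  by case: (h t t').
move=> u0 u1 v0 vu cuv suv.
have : cos ((u - v) * pi *+ 2) = 1.
  rewrite -mulrnAr mulrBl cosB cuv suv -!expr2; exact: cos2Dsin2.
rewrite cos_mulr2n cos2sin2 => h.
have : 0 < sin ((u - v) * pi).
  apply: sin_gt0_pi; rewrite mulr_gt0 ?subr_gt0 ?pi_gt0//= gtr_pMl ?pi_gt0//; lra.
move: h; move: (sin _) => x; rewrite mulr2n => h x0; have : 0 < x ^+ 2 by rewrite exprn_gt0.
lra.
Qed.

(** The angle jumps at the point [(1, 0)], so it is only Borel. Since [acos] decreases, the
    preimages of half-lines under [acos \o c] are open conditions on [c]. *)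
Lemma circle_angle_borel {G : topologicalZmodType} (c s : G -> R) :
  continuous c -> continuous s -> (forall x, c x ^+ 2 + s x ^+ 2 = 1) ->
  measurable_fun [set: borel G] (fun x => circle_angle (c x) (s x)).
Proof.
move=> cc cs unit_circle.
have macos : measurable_fun [set: borel G] (fun x => acos (c x)).
  apply: (measurability _ (RGenInftyO.measurableE R)).
  move=> _ [_ [y ->] <-]; rewrite setTI; apply: borel_open.
  have [y0|y0] := leP y 0.
    rewrite [X in open X](_ : _ = set0); first exact: open0.
    apply/seteqP; split => // x; rewrite /= in_itv /= => h.
    have := acos_ge0 (circle_bound (unit_circle x)); lra.
  have [ypi|ypi] := ltP pi y.
    rewrite [X in open X](_ : _ = setT); first exact: openT.
    apply/seteqP; split => // x _; rewrite /= in_itv /=.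
    exact: le_lt_trans (acos_lepi (circle_bound (unit_circle x))) ypi.
  rewrite [X in open X](_ : _ = c @^-1` [set r | cos y < r]); last first.
    have yitv : y \in `[0, pi] by rewrite in_itv /= ltW.
    have E x : (acos (c x) < y) = (cos y < c x).
      have cx := circle_bound (unit_circle x).
      rewrite -[in RHS](@acosK _ (c x)) ?in_itv// ltr_cos//.
      by rewrite in_itv /= acos_ge0// acos_lepi.
    by apply/seteqP; split => x; rewrite /= in_itv /= E.
  by apply: open_comp; [move=> x _; exact: cc|exact: open_gt].
apply: measurable_fun_ifT.
- by apply: measurable_fun_ler; [exact: measurable_cst|exact: continuous_borel].
- by apply: measurable_funM => //; exact: measurable_cst.
- apply: measurable_funB; first exact: measurable_cst.
  by apply: measurable_funM => //; exact: measurable_cst.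
Qed.

End circle_angle.

(** * Sine and angle recovered from the cosine *)

Section dalembert_angle.
Context {R : realType} {G : topologicalZmodType}.
Variable c : G -> R.
Hypotheses (cc : continuous c) (c0 : c 0 = 1) (c1 : forall x, `|c x| <= 1).
Hypothesis cD : forall x y, c (x + y) + c (x - y) = 2 * c x * c y.
Variable b : G.
Hypotheses (cb : c b != 1) (connG : connected [set: G]).

Lemma dalembert_even x : c (- x) = c x.
Proof. by have := cD 0 x; rewrite add0r sub0r c0; lra. Qed.

Lemma dalembert_ivt (r : R) : c b <= r <= 1 -> exists x, c x = r.
Proof.
move=> r01; have : connected (range c).
  by apply: connected_continuous_connected => //; exact: continuous_subspaceT.
move=> /connected_intervalP /(_ (c b) (c 0)) /(_ _ _ r); rewrite c0.
by case=> [||//|x _ <-]; [exists b|exists 0|exists x].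
Qed.

Let cb1 : c b < 1.
Proof. by rewrite lt_neqAle cb (le_trans (ler_norm _) (c1 b)). Qed.

Let cbN1 : -1 <= c b.
Proof. by have := c1 b; rewrite ler_norml => /andP[]. Qed.

Let mid : c b <= (1 + c b) / 2 <= 1.
Proof. by have := cb1; lra. Qed.

(** An element with cosine strictly between -1 and 1, so that its sine [sg] can be divided by. *)
Let a := sval (cid (dalembert_ivt mid)).
Let ca : c a = (1 + c b) / 2. Proof. by rewrite /a; case: cid. Qed.

Let sg := Num.sqrt (1 - c a ^+ 2).
Let sg2 : sg ^+ 2 = 1 - c a ^+ 2.
Proof. by rewrite sqr_sqrtr// ca; have := cb1; have := cbN1; nra. Qed.
Let sg0 : 0 < sg.
Proof. by rewrite sqrtr_gt0 ca; have := cb1; have := cbN1; nra. Qed.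

(** The sine, read off from [cos (x - a) - cos (x + a) = 2 sin x sin a]. Taking [sg] positive fixes
    the orientation. *)
Let s x := (c (x - a) - c (x + a)) / (2 * sg).

Let sgN0 := lt0r_neq0 sg0.

Let prod x y : c x * c y = (c (x + y) + c (x - y)) / 2.
Proof. by rewrite cD; field. Qed.

(** Expanding the four products of cosines and regrouping the shifts by [a + a] leaves the factor
    [1 - c (a + a)], equal to [2 sg^2]. *)
Lemma sine_mul x y : s x * s y = (c (x - y) - c (x + y)) / 2.
Proof.
have -> : s x * s y = (c (x - a) - c (x + a)) * (c (y - a) - c (y + a)) / (4 * sg ^+ 2).
  by rewrite /s; field.
have caa : 1 - c a ^+ 2 = (1 - c (a + a)) / 2.
  by rewrite expr2 prod subrr c0; field.
have caa0 : 1 - c (a + a) != 0.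
  by apply: contraNneq sgN0 => h; rewrite -sqrf_eq0 sg2 caa h mul0r.
have h1 : c (x - a) * c (y - a) = (c (x + y - (a + a)) + c (x - y)) / 2.
  by rewrite prod; congr ((c _ + c _) / 2); [rewrite addrACA -opprD|rewrite opprB addrA subrK].
have h2 : c (x + a) * c (y + a) = (c (x + y + (a + a)) + c (x - y)) / 2.
  by rewrite prod; congr ((c _ + c _) / 2); [rewrite addrACA|rewrite opprD addrACA subrr addr0].
have h3 : c (x - a) * c (y + a) = (c (x + y) + c (x - y - (a + a))) / 2.
  rewrite prod; congr ((c _ + c _) / 2); first by rewrite addrACA addNr addr0.
  by rewrite opprD addrACA -opprD.
have h4 : c (x + a) * c (y - a) = (c (x + y) + c (x - y + (a + a))) / 2.
  rewrite prod; congr ((c _ + c _) / 2); first by rewrite addrACA subrr addr0.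
  by rewrite opprD opprK addrACA.
have h5 := cD (x + y) (a + a); have h6 := cD (x - y) (a + a).
have -> : (c (x - a) - c (x + a)) * (c (y - a) - c (y + a)) =
   (1 - c (a + a)) * (c (x - y) - c (x + y)).
  rewrite mulrBl !mulrBr h1 h2 h3 h4; lra.
by rewrite sg2 caa; field.
Qed.

Lemma cos_add x y : c (x + y) = c x * c y - s x * s y.
Proof. by rewrite sine_mul prod; field. Qed.

Lemma sin_add x y : s (x + y) = s x * c y + c x * s y.
Proof.
rewrite /s.
have -> : (c (x - a) - c (x + a)) / (2 * sg) * c y + c x * ((c (y - a) - c (y + a)) / (2 * sg)) =
  (c (x - a) * c y - c (x + a) * c y + c x * c (y - a) - c x * c (y + a)) / (2 * sg) by field.
congr (_ / _); rewrite !prod.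
have -> : x - a + y = x + y - a by rewrite addrAC.
have -> : x + a + y = x + y + a by rewrite addrAC.
have -> : x + (y - a) = x + y - a by rewrite addrA.
have -> : x + (y + a) = x + y + a by rewrite addrA.
have -> : x - (y - a) = x + a - y by rewrite opprB addrA.
have -> : x - (y + a) = x - a - y by rewrite opprD addrA addrAC.
by field.
Qed.

Lemma sineN x : s (- x) = - s x.
Proof.
rewrite /s -opprD dalembert_even -[- x + a]opprK opprD opprK dalembert_even; field.
exact: sgN0.
Qed.

Lemma unit_circle x : c x ^+ 2 + s x ^+ 2 = 1.
Proof.
have := cos_add x (- x); rewrite subrr c0 sineN dalembert_even => ->; ring.
Qed.

Definition dalembert_angle x := circle_angle (c x) (s x).

Let th := dalembert_angle.
Local Notation tau := ((pi : R) *+ 2).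

Let thK x : cos (th x * tau) = c x /\ sin (th x * tau) = s x.
Proof. exact: circle_angleK (unit_circle x). Qed.

Let th01 x : 0 <= th x < 1.
Proof. exact: circle_angle_range (unit_circle x). Qed.

Let th_uniq x t : 0 <= t < 1 -> cos (t * tau) = c x -> sin (t * tau) = s x -> th x = t.
Proof.
by move=> t01 ct st; have [cx sx] := thK x; apply: angle_inj => //; rewrite (ct, st).
Qed.

Let thD x y : exists k : int, th (x + y) = th x + th y - k%:~R.
Proof.
have [/andP[x0 x1] /andP[y0 y1]] := (th01 x, th01 y).
have [cx sx] := thK x; have [cy sy] := thK y.
have cxy : cos ((th x + th y) * tau) = c (x + y) by rewrite mulrDl cosD cx sx cy sy cos_add.
have sxy : sin ((th x + th y) * tau) = s (x + y) by rewrite mulrDl sinD cx sx cy sy sin_add.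
have [xy1|xy1] := ltP (th x + th y) 1.
  by exists 0; rewrite subr0; apply: th_uniq => //; rewrite addr_ge0.
exists 1; apply: th_uniq; first by lra.
  by rewrite -cosD2pi mulrBl mul1r subrK.
by rewrite -sinD2pi mulrBl mul1r subrK.
Qed.

Let th_mul x n : exists k : int, th (x *+ n) = n%:R * th x - k%:~R.
Proof.
elim: n => [|n [k IH]].
  exists 0; rewrite mul0r subr0 mulr0n; apply: th_uniq; rewrite ?lexx ?ltr01//.
    by rewrite mul0r cos0 c0.
  by rewrite mul0r sin0; have := sineN 0; rewrite oppr0; lra.
have [k' E] := thD (x *+ n) x; exists (k + k').
by rewrite mulrSr E IH -natr1 intrD; ring.
Qed.

Let th_mulE x n t : 0 <= t < 1 -> n%:R * th x = t -> th (x *+ n) = t.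
Proof.
move=> /andP[t0 t1] nt; have [k E] := th_mul x n; move: E; rewrite nt => E.
have /andP[u0 u1] := th01 (x *+ n).
have k0 : -1 < k by rewrite -(ltr_int R); lra.
have k1 : k < 1 by rewrite -(ltr_int R); lra.
suff k_eq : k = 0 by rewrite E k_eq subr0.
by move: k0 k1; case: (k) => [[|n']|n'].
Qed.

(** The cosine fixes an angle up to sign, and one of [x], [- x] has the nonnegative sine
    required. *)
Let th_small t : 0 <= t -> t <= acos (c b) / tau -> exists x, th x = t.
Proof.
have cb2 : -1 <= c b <= 1 by rewrite cbN1 ltW.
move=> t0 tb; have tau0 := @tau_gt0 R.
have tpi : 0 <= t * tau <= acos (c b) by rewrite mulr_ge0 ?(ltW tau0)//= -ler_pdivlMr.
have apib : acos (c b) <= pi by exact: acos_lepi.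
have tpi' : t * tau \in `[0, pi].
  by rewrite in_itv /=; case/andP: tpi => -> /le_trans; apply.
have aitv : acos (c b) \in `[0, pi] by rewrite in_itv /= acos_ge0.
have [x cx] : exists x, c x = cos (t * tau).
  apply: dalembert_ivt; rewrite cos_le1 andbT -[leLHS]acosK ?in_itv//=.
  by rewrite leNgt ltr_cos// -leNgt; case/andP: tpi.
have t1 : t < 1.
  rewrite -(ltr_pM2r tau0) mul1r; case/andP: tpi => _ /le_lt_trans; apply.
  by apply: le_lt_trans apib _; rewrite mulr2n ltrDl pi_gt0.
have st : 0 <= sin (t * tau) by apply: sin_ge0_pi; case/andP: tpi => -> /le_trans ->.
have s2 : s x ^+ 2 = sin (t * tau) ^+ 2 by rewrite sin2cos2 -cx -(unit_circle x); ring.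
have [sx|sx] : s x = sin (t * tau) \/ s x = - sin (t * tau).
  by move/eqP: s2; rewrite eqf_sqr => /orP[]/eqP; [left|right].
  by exists x; apply: th_uniq => //; rewrite t0.
exists (- x); apply: th_uniq; rewrite ?t0 ?dalembert_even ?sineN ?sx ?opprK//.
Qed.

(** [th_small] only reaches an initial arc; a larger [t] is [n] times a small angle, with no integer
    part to remove since [t] lies in [[0, 1[]. *)
Let th_surj t : 0 <= t < 1 -> exists x, th x = t.
Proof.
move=> /andP[t0 t1]; have tau0 := @tau_gt0 R.
have al0 : 0 < acos (c b) / tau by rewrite divr_gt0// acos_gt0 ?cbN1.
pose n := (Num.truncn (t / (acos (c b) / tau))).+1.
have n0 : 0 < n%:R :> R by [].
have [x xn] : exists x, th x = t / n%:R.
  apply: th_small; first by rewrite divr_ge0.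
  rewrite ler_pdivrMr// mulrC -ler_pdivrMr//; exact/ltW/truncnS_gt.
by exists (x *+ n); apply: th_mulE; rewrite ?t0// xn mulrC divfK// gt_eqF.
Qed.

Let s_continuous : continuous s.
Proof.
move=> x; apply: cvgMl; apply: cvgB.
  exact: (continuous_translate (a := - a) cc).
exact: (continuous_translate (a := a) cc).
Qed.

Theorem dalembert_angle_map : angle_map th /\ th b != 0.
Proof.
split; first by apply: AngleMap; [exact: th01|exact: thD|exact: th_surj|exact: circle_angle_borel cc s_continuous unit_circle].
apply/eqP => tb; have [] := thK b; rewrite tb mul0r cos0 => h.
by move: cb; rewrite -h eqxx.
Qed.

End dalembert_angle.

(** * The torus *)

Section torus_topology.
Context {R : realType} {n : nat}.
Implicit Types (x y : torus R n) (i : 'I_n).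

Local Notation tau := ((pi : R) *+ 2).

Lemma torus_pi_continuous : continuous (@torus_pi R n).
Proof. exact: pi_continuous. Qed.

Lemma torus_pi_coord x : torus_pi (\row_i torus_coord x i) = x.
Proof.
rewrite -[RHS]torus_piK; apply/torus_pi_eq/mxOverP => i j.
have E (u v : R) : u - v - u = - v by ring.
by rewrite !mxE /torus_coord (ord1 i) E rpredN intr_int.
Qed.

Lemma torus_compact : compact [set: torus R n].
Proof.
have -> : [set: torus R n] = @torus_pi R n @` [set v : 'rV[R]_n | forall i, `[0, 1]%classic (v ord0 i)].
  apply/seteqP; split => // x _; exists (\row_i torus_coord x i); last exact: torus_pi_coord.
  move=> i; rewrite mxE /= in_itv /=; have /andP[-> /ltW ->//] := torus_coord_ge0_lt1 x i.
apply: continuous_compact; first exact/continuous_subspaceT/torus_pi_continuous.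
apply: (@rV_compact R n (fun=> `[0, 1]%classic)) => i; exact: segment_compact.
Qed.

Lemma torus_connected : connected [set: torus R n].
Proof.
have -> : [set: torus R n] = \bigcup_(v in [set: 'rV[R]_n])
    ((fun t : R => torus_pi (t *: v)) @` [set: R]).
  by apply/seteqP; split => // x _; exists (repr x) => //; exists 1 => //; rewrite scale1r torus_piK.
apply: bigcup_connected.
  by exists (torus_pi 0) => v _; exists 0 => //; rewrite scale0r.
move=> v _; apply: connected_continuous_connected.
  by apply/connected_intervalP => ? ? ? ? ? ?.
apply: continuous_subspaceT => t.
apply: (@continuous_comp _ _ _ (fun t : R => t *: v) (@torus_pi R n)).
  by apply: cvgZr_tmp; exact: cvg_id.
exact: torus_pi_continuous.
Qed.

Lemma torus_coordD x y i : exists k : int,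
  torus_coord (x + y) i = torus_coord x i + torus_coord y i - k%:~R.
Proof.
have pi0 : @torus_pi R n 0 = 0 by rewrite -(subrr 0) torus_piB subrr.
have -> : x + y = torus_pi ((\row_j torus_coord x j) - (0 - \row_j torus_coord y j)).
  by rewrite !torus_piB !torus_pi_coord pi0 sub0r opprK.
exists (Num.floor (torus_coord x i + torus_coord y i)).
by rewrite torus_coord_pi !mxE sub0r opprK.
Qed.

Lemma torus_coord_surj i (t : R) : 0 <= t < 1 -> exists x, torus_coord x i = t.
Proof.
move=> /andP[t0 t1]; exists (torus_pi (const_mx t)); rewrite torus_coord_pi mxE.
by rewrite (floor_def (m := 0)) ?subr0// t0 add0r.
Qed.

(** A coordinate jumps at 0, but a periodic function absorbs the integer part of a lift and so
    descends continuously to the quotient. *)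
Let coord_angle i (f : R -> R) : continuous f -> (forall u, f (u + tau) = f u) ->
  continuous (fun x => f (torus_coord x i * tau)).
Proof.
move=> cf fper; apply/quotient_continuous => v.
have fperz (k : int) u : f (u + k%:~R * tau) = f u.
  have fpern (m : nat) w : f (w + m%:R * tau) = f w.
    by elim: m => [|m IH]; rewrite ?mul0r ?addr0// -natr1 mulrDl mul1r addrA fper IH.
  case: k => m; first exact: fpern.
  by rewrite NegzE mulrNz mulNr -[in RHS](subrK (m.+1%:R * tau) u) fpern.
have -> : (fun x => f (torus_coord x i * tau)) \o \pi_(quotient_topology (Quotient.quot (@int_rV R n)))%qT =
    (fun v : 'rV[R]_n => f (v ord0 i * tau)).
  apply/funext => w /=; rewrite -/(torus_pi w) torus_coord_pi mulrBl -mulNr -mulrNz.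
  exact: fperz.
have cv : continuous (fun w : 'rV[R]_n => w ord0 i * tau).
  move=> w; have h := @coord_continuous R 1 n ord0 i w; exact: (cvgM h (cvg_cst tau)).
by apply: continuous_comp; [exact: cv|exact: cf].
Qed.

Let cos_coord i x := cos (torus_coord x i * tau).
Let sin_coord i x := sin (torus_coord x i * tau).

Let cos_coord_continuous i : continuous (cos_coord i).
Proof. by apply: coord_angle; [exact: continuous_cos|exact: cosD2pi]. Qed.

Let sin_coord_continuous i : continuous (sin_coord i).
Proof. by apply: coord_angle; [exact: continuous_sin|exact: sinD2pi]. Qed.

Let unit_coord i x : cos_coord i x ^+ 2 + sin_coord i x ^+ 2 = 1.
Proof. exact: cos2Dsin2. Qed.

(** The cosines and sines of the coordinates are continuous and together separate points. *)
Lemma torus_hausdorff : hausdorff_space (torus R n).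
Proof.
have sep (f : torus R n -> R) x y : continuous f -> f x != f y ->
    exists2 AB, (x \in AB.1 /\ y \in AB.2) & [/\ open AB.1, open AB.2 & AB.1 `&` AB.2 == set0].
  move=> cf fxy; have := @Rhausdorff R; rewrite open_hausdorff => /(_ _ _ fxy).
  move=> [[A B] /= [fA fB] [oA oB AB]]; exists (f @^-1` A, f @^-1` B) => /=.
    by split; apply: mem_set; exact: set_mem.
  split; [by apply: open_comp => // z _; exact: cf|by apply: open_comp => // z _; exact: cf|].
  by rewrite -preimage_setI (eqP AB) preimage_set0.
rewrite open_hausdorff => x y xy.
have [i xyi] : exists i, torus_coord x i != torus_coord y i.
  apply: contrapT => /forallNP h; move/negP: xy; apply; apply/eqP.
  rewrite -(torus_pi_coord x) -(torus_pi_coord y); congr torus_pi; apply/rowP => i.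
  by rewrite !mxE; apply/eqP; have /negP := h i; rewrite negbK.
have [cxy|] := eqVneq (cos_coord i x) (cos_coord i y); last exact: sep.
have [sxy|] := eqVneq (sin_coord i x) (sin_coord i y); last exact: sep.
by move: xyi; rewrite (angle_inj _ _ cxy sxy) ?eqxx// torus_coord_ge0_lt1.
Qed.

Lemma torus_coord_angle_map i : angle_map (fun x : torus R n => torus_coord x i).
Proof.
apply: AngleMap.
- by move=> x; exact: torus_coord_ge0_lt1.
- by move=> x y; exact: torus_coordD.
- exact: torus_coord_surj.
(* The coordinate is a Borel function of its continuous cosine and sine. *)
rewrite [X in measurable_fun _ X](_ : _ = fun x => circle_angle (cos_coord i x) (sin_coord i x)).
  exact: circle_angle_borel.
apply/funext => x; have [ct st] := circle_angleK (unit_coord i x).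
by apply: angle_inj; rewrite ?torus_coord_ge0_lt1 ?circle_angle_range// (ct, st).
Qed.

End torus_topology.

(** * The extremal value of the logarithmic integral *)

Section extremal.
Context {R : realType} {G : topologicalZmodType} (mu : probability (borel G) R).
Variable b : G.
Hypotheses (cptG : compact [set: G]) (connG : connected [set: G]).
Hypotheses (hausG : hausdorff_space G) (haar : is_haar mu).

Lemma log_integralE (pi : G -> R) : (forall x, pi x <= 1) ->
  log_integral mu pi = (- \int[haar_completion mu]_x (- lne (pi x)%:E))%E.
Proof.
move=> pi1; rewrite /log_integral -integral_ge0N.
  by apply: eq_integral => x _; rewrite oppeK.
by move=> x _; rewrite oppe_ge0 lne_le0 lee_fin.
Qed.

Lemma integral_ln_minimal_le1 pi : minimal_measurable mu b pi ->
  (\int[haar_completion mu]_x (- lne (pi x)%:E) <= 1)%E.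
Proof.
move=> [mini mpi]; have [[pi0 _] _] := mini.
apply: (integral_ln_le1 (haar_completion_setT mu)) => //.
  by move=> x; exact: minimal_le1 mini.
move=> s t; apply: (cvol_sublevel_superadditive cptG hausG haar connG (b := b)) => //.
- by move=> x y; exact: minimal_subadditive mini.
- exact: valid_ge1 mini.1.
Qed.

Lemma log_integral_ge pi : minimal_measurable mu b pi -> (-1 <= log_integral mu pi)%E.
Proof.
move=> mm; rewrite log_integralE; last by move=> x; exact: minimal_le1 mm.1.
by rewrite leeN2 integral_ln_minimal_le1.
Qed.

Lemma log_integral_gmi (th : G -> R) : angle_map th -> th b != 0 ->
  minimal_measurable mu b (fun x => gmi (th b) (th x)) /\
  log_integral mu (fun x => gmi (th b) (th x)) = (-1)%E.
Proof.
move=> thA thb; have mm := gmi_minimal_measurable mu thA thb; split => //.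
apply/eqP; rewrite eq_le log_integral_ge// andbT.
rewrite log_integralE; last by move=> x; exact: minimal_le1 mm.1.
by rewrite leeN2; exact: integral_ln_gmi_ge1.
Qed.

Lemma ereal_inf_log_integral (th : G -> R) : angle_map th -> th b != 0 ->
  ereal_inf [set log_integral mu pi | pi in minimal_measurable mu b] = (-1)%E.
Proof.
move=> thA thb; have [mm <-] := log_integral_gmi thA thb.
apply/eqP; rewrite eq_le; apply/andP; split.
  by apply: ereal_inf_lbound; exists (fun x => gmi (th b) (th x)).
apply: le_ereal_inf_tmp => _ [pi mpi <-].
by rewrite (log_integral_gmi thA thb).2 log_integral_ge.
Qed.

End extremal.

Theorem theorem2p3 (R : realType) :
  (forall (G : topologicalZmodType) (mu : probability (borel G) R) (b : G),
     compact [set: G] -> connected [set: G] -> hausdorff_space G ->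
     is_haar mu -> b != 0 ->
     (forall pi, minimal_measurable mu b pi ->
        (haar_completion mu).-integrable setT (fun x => - lne (pi x)%:E)%E) /\
     ereal_inf [set log_integral mu pi | pi in minimal_measurable mu b]
       = (- 1)%E) /\
  (forall (n : nat) (mu : probability (borel (torus R n)) R)
     (b : torus R n) (i : 'I_n),
     is_haar mu -> torus_coord b i != 0 ->
     minimal_measurable mu b (GMI b i) /\
     log_integral mu (GMI b i)
       = ereal_inf [set log_integral mu pi | pi in minimal_measurable mu b]).
Proof.
split=> [G mu b cptG connG hausG haar b0|n mu b i haar bi].
  split=> [pi mm|].
    apply/integrableP; split; first exact: measurable_lne mm.2.
    apply: (@le_lt_trans _ _ 1%E); last by rewrite ltry.
    apply: le_trans (integral_ln_minimal_le1 cptG connG hausG haar mm).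
    rewrite le_eqVlt; apply/orP; left; apply/eqP; apply: eq_integral => x _.
    by rewrite gee0_abs// oppe_ge0 lne_le0 lee_fin; exact: minimal_le1 mm.1.
  have [c [cc c0 c1 cD cb]] := exists_dalembert cptG hausG haar b0.
  have [thA thb] := dalembert_angle_map cc c0 c1 cD cb connG.
  exact: ereal_inf_log_integral thA thb.
have thA := @torus_coord_angle_map R n i.
have [[cT kT] hT] := (@torus_compact R n, @torus_connected R n, @torus_hausdorff R n).
(* [GMI b i] is convertible to [gmi] of the coordinates, so [mm] and [E] apply to it as they
   stand. *)
have [mm E] := log_integral_gmi cT kT hT haar thA bi; split; first exact: mm.
by rewrite (ereal_inf_log_integral cT kT hT haar thA bi); exact: E.
Qed.
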